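(* Consider the Bayesian quantile regression posterior $\Pi(\cdot \mid X, Y)$ on $\mathbb{R}^d \times (0,\infty)$, with normalizing constant $Z_{\Pi(\cdot|X,Y)}$, and let $P$ be the Metropolis-Hastings independence kernel with target $\Pi(\cdot\mid X,Y)$ and the normal-inverse-gamma proposal $\sigma \sim \mathrm{IG}(n + v_0, s_0 + s_{n,r}(\beta^* ))$, $\beta \mid \sigma \sim \mathrm{N}_d(\beta^*, \sigma C)$, where $\beta^*$ is the unique minimizer of $s_{n,r}$ (all as in the context). Define $$\epsilon_{\beta^*} = Z_{\Pi(\cdot | X, Y)} \left( 2 \pi \right)^{-d/2} \det(C)^{-1/2} \left( s_0 + s_{n, r}(\beta^* ) \right)^{n + v_0} \Gamma(n + v_0)^{-1},$$ where $\Gamma$ is the Gamma function. Then for any $\sigma_0 \in (0,\infty)$, any lower semicontinuous metric $\rho$ on $\mathbb{R}^d\times(0,\infty)$ and every integer $t \ge 1$, $$\mathcal{W}_{\rho}\left( P^t( (\beta^*, \sigma_0), \cdot ), \Pi(\cdot | X, Y) \right) = \left( 1 - \epsilon_{\beta^*} \right)^t \int \rho((\beta, \sigma), (\beta^*, \sigma_0))\, d\Pi(\beta, \sigma | X, Y).$$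
   Context: Model: fix $r \in (0,1)$, $v_0, s_0 \in (0,\infty)$, a symmetric positive-definite matrix $C \in \mathbb{R}^{d\times d}$, an integer $n \ge 1$, and fixed vectors $X_1,\dots,X_n \in \mathbb{R}^d$ and observed responses $Y_1,\dots,Y_n \in \mathbb{R}$. $\mathrm{IG}(v,s)$ denotes the inverse gamma distribution with density on $(0,\infty)$ proportional to $\sigma^{-v-1}\exp(-s/\sigma)$. The Bayesian quantile regression model is $\sigma \sim \mathrm{IG}(v_0,s_0)$, $\beta \mid \sigma \sim \mathrm{N}_d(0,\sigma C)$, $Y_i = \beta^T X_i + \sigma \epsilon_i$ for $i=1,\dots,n$, where the $\epsilon_i$ are i.i.d. with density $p_r(\epsilon) = r(1-r)\left(\exp((1-r)\epsilon) I_{\epsilon<0} + \exp(-r\epsilon) I_{\epsilon \ge 0}\right)$. Let $\ell_r(u) = u(r - I_{u<0})$ and $s_{n,r}(\beta) = \sum_{i=1}^n \ell_r(Y_i - \beta^T X_i) + \beta^T C^{-1}\beta/2$. The function $s_{n,r}$ is strongly convex; $\beta^* \in \mathbb{R}^d$ is its unique minimizer. The posterior $\Pi(\cdot\mid X,Y)$ has Lebesgue density on $\mathbb{R}^d\times(0,\infty)$ $$\pi(\beta,\sigma\mid X,Y) = Z_{\Pi(\cdot|X,Y)}^{-1} \exp\left(-\frac{s_0 + s_{n,r}(\beta)}{\sigma} - (n+v_0+1+d/2)\log\sigma\right),$$ with $Z_{\Pi(\cdot|X,Y)}$ the corresponding normalizing constant. Metropolis-Hastings independence kernel: on $\Theta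 = \mathbb{R}^d\times(0,\infty)$ with target density $\pi$ and proposal density $q$ (both strictly positive on $\Theta$), let $a(\theta,\theta') = \min\left\{ \frac{\pi(\theta') q(\theta)}{\pi(\theta) q(\theta')}, 1\right\}$ and $$P(\theta, B) = \int_B a(\theta,\theta') q(\theta')\, d\theta' + \delta_\theta(B)\left(1 - \int a(\theta,\theta') q(\theta')\, d\theta'\right),$$ where $\delta_\theta$ is the Dirac measure at $\theta$; $P^1=P$ and $P^t(\theta,B) = \int P(\theta,d\theta')P^{t-1}(\theta',B)$ for $t\ge 2$. The proposal is assumed to differ from the target. Wasserstein distance: for a lower semicontinuous metric $\rho$ (lower semicontinuous as a function of two arguments with respect to the Euclidean topology), $\mathcal{W}_\rho(\mu,\nu) = \inf_{\xi\in\mathcal{C}(\mu,\nu)}\int\rho\,d\xi$, where $\mathcal{C}(\mu,\nu)$ is the set of joint probability measures with marginals $\mu$ and $\nu$. Values in $[0,+\infty]$ are allowed. *)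

(* Defs.v *)
From HB Require Import structures.
From mathcomp Require Import all_boot all_order all_algebra.
From mathcomp Require Import all_classical all_reals all_analysis.

Set Implicit Arguments.
Unset Strict Implicit.
Unset Printing Implicit Defensive.

Import Order.TTheory GRing.Theory Num.Theory.
Import numFieldNormedType.Exports.

Local Open Scope classical_set_scope.
Local Open Scope ring_scope.

(* Vectors of R^d are column matrices 'cV[R]_d.  They carry the sigma-algebra
   generated by the coordinates, i.e. the Borel sigma-algebra of the canonical
   (Euclidean) topology of 'M[R]_(m, n). *)
Section matrix_measurable.
Context {R : realType} (m n : nat).

Definition mx_cylinders : set (set 'M[R]_(m, n)) :=
  [set A | exists i j, exists2 B : set R, measurable B &
     A = [set M : 'M[R]_(m, n) | B (M i j)]].

Let measurable_mx : set (set 'M[R]_(m, n)) := <<s mx_cylinders >>.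

Let mx0 : measurable_mx set0. Proof. exact: sigma_algebra0. Qed.

Let mxC A : measurable_mx A -> measurable_mx (~` A).
Proof. exact: sigma_algebraC. Qed.

Let mxU (F : (set 'M[R]_(m, n))^nat) :
  (forall i, measurable_mx (F i)) -> measurable_mx (\bigcup_i F i).
Proof. exact: sigma_algebra_bigcup. Qed.

HB.instance Definition _ := @isMeasurable.Build (sigma_display mx_cylinders)
  'M[R]_(m, n) measurable_mx mx0 mxC mxU.

End matrix_measurable.

Section lebesgue_step.
Local Open Scope ereal_scope.
Context {R : realType} (d : nat).

Definition cons_cV (p : measurableTypeR R * 'cV[R]_d) : 'cV[R]_d.+1 :=
  col_mx (p.1%:M : 'M[R]_1) p.2.

Lemma cons_cVE0 p i j : cons_cV p (lshift d i : 'I_(1 + d)) j = p.1.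
Proof. by rewrite /cons_cV (@col_mxEu R 1 d 1) !ord1 mxE eqxx mulr1n. Qed.

Lemma cons_cVES p i j : cons_cV p (rshift 1 i : 'I_(1 + d)) j = p.2 i j.
Proof. by rewrite /cons_cV (@col_mxEd R 1 d 1). Qed.

Lemma measurable_cons_cV : measurable_fun setT cons_cV.
Proof.
apply: (measurability (@mx_cylinders R d.+1 1)) => //.
move=> _ [_ [i [j [B mB ->]]] <-]; rewrite setTI.
rewrite -(@splitK 1 d i); case: (@fintype.split 1 d i) => k /=.
- rewrite [X in measurable X](_ : _ = B `*` setT); last first.
    by apply/seteqP; split=> p /=; rewrite cons_cVE0// => -[].
  exact: measurableX.
- rewrite [X in measurable X](_ : _ =
      setT `*` [set M : 'cV[R]_d | B (M k j)]); last first.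
    by apply/seteqP; split=> p /=; rewrite cons_cVES// => -[].
  apply: measurableX => //; apply: sub_sigma_algebra.
  by exists k, j, B.
Qed.

Context (mu : {sigma_finite_measure set 'cV[R]_d -> \bar R}).

Definition lebesgue_cVS : set 'cV[R]_d.+1 -> \bar R :=
  pushforward ((@lebesgue_measure R) \x mu) cons_cV.

Let lebesgue_cVS0 : lebesgue_cVS set0 = 0.
Proof. by rewrite /lebesgue_cVS /pushforward preimage_set0 measure0. Qed.

Let lebesgue_cVS_ge0 A : 0 <= lebesgue_cVS A.
Proof. by rewrite /lebesgue_cVS /pushforward measure_ge0. Qed.

Let lebesgue_cVS_additive : semi_sigma_additive lebesgue_cVS.
Proof.
move=> F mF tF mUF; rewrite /lebesgue_cVS /pushforward preimage_bigcup.
apply: measure_semi_sigma_additive.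
- by move=> n; rewrite -[X in measurable X]setTI; exact: measurable_cons_cV.
- apply/trivIsetP => /= i j _ _ ij; rewrite -preimage_setI.
  by move/trivIsetP : tF => /(_ _ _ _ _ ij) ->//; rewrite preimage_set0.
- by rewrite -preimage_bigcup -[X in measurable X]setTI;
    exact: measurable_cons_cV.
Qed.

HB.instance Definition _ := isMeasure.Build _ _ _ lebesgue_cVS
  lebesgue_cVS0 lebesgue_cVS_ge0 lebesgue_cVS_additive.

Lemma measurable_coord m n (i : 'I_m) (j : 'I_n) :
  measurable_fun setT (fun M : 'M[R]_(m, n) => M i j).
Proof.
by move=> _ B mB; rewrite setTI; apply: sub_sigma_algebra; exists i, j, B.
Qed.

Lemma measurable_behead_cV :
  measurable_fun setT (fun v : 'cV[R]_d.+1 => @dsubmx R 1 d 1 v).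
Proof.
apply: (measurability (@mx_cylinders R d 1)) => //.
move=> _ [_ [i [j [B mB ->]]] <-]; rewrite setTI.
rewrite [X in measurable X](_ : _ =
  (fun M : 'cV[R]_d.+1 => M (rshift 1 i : 'I_(1 + d)) j) @^-1` B); last first.
  by apply/seteqP; split=> v /=; rewrite mxE.
by rewrite -[X in measurable X]setTI; exact: measurable_coord.
Qed.

Let lebesgue_cVS_sigma_finite : sigma_finite setT lebesgue_cVS.
Proof.
have [A [TA ndA Aoo]] : exists A : (set (measurableTypeR R))^nat,
    [/\ [set: measurableTypeR R] = \bigcup_i A i, nondecreasing_seq A &
     forall i, measurable (A i) /\ lebesgue_measure (A i) < +oo].
  by apply/sigma_finiteP; exact: sigma_finiteT.
have /sigma_finiteP[B [TB ndB Boo]] := sigma_finiteT mu.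
pose F n := A n `*` B n.
have TF : \bigcup_n F n = setT.
  rewrite -setXTT TA TB predeqE => -[x v]; split.
    by move=> [n _ []/= ? ?]; split; exists n.
  move=> [/= [n _ Anx] [k _ Bkv]]; exists (maxn n k) => //; split.
  - by move: x Anx; exact/subsetPset/ndA/leq_maxl.
  - by move: v Bkv; exact/subsetPset/ndB/leq_maxr.
have Foo n : measurable (F n) /\ (lebesgue_measure \x mu) (F n) < +oo.
  have [? ?] := Aoo n; have [? ?] := Boo n; split; first exact: measurableX.
  by rewrite product_measure1E// lte_mul_pinfty// ge0_fin_numE.
pose uncons (v : 'cV[R]_d.+1) : measurableTypeR R * 'cV[R]_d :=
  (v (lshift d (ord0 : 'I_1) : 'I_(1 + d)) ord0, @dsubmx R 1 d 1 v).
have unconsK p : uncons (cons_cV p) = p.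
  by case: p => x v; rewrite /uncons cons_cVE0 /cons_cV col_mxKd.
have muncons : measurable_fun setT uncons.
  apply/measurable_fun_pairP; split; last exact: measurable_behead_cV.
  exact: measurable_coord.
exists (fun n => uncons @^-1` F n).
  by rewrite -preimage_bigcup TF preimage_setT.
move=> n; have [mF Fn] := Foo n; split.
  by rewrite -[X in measurable X]setTI; exact: muncons.
rewrite /lebesgue_cVS /pushforward.
rewrite (_ : cons_cV @^-1` (uncons @^-1` F n) = F n)//.
by apply/seteqP; split=> p /=; rewrite unconsK.
Qed.

HB.instance Definition _ := Measure_isSigmaFinite.Build _ _ _ lebesgue_cVS
  lebesgue_cVS_sigma_finite.

End lebesgue_step.

(* Lebesgue measure on R^d, as the d-fold product of the one-dimensional
   Lebesgue measure; on the one-point space R^0 it is the unit mass. *)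
Fixpoint lebesgue_cV {R : realType} (d : nat) :
    {sigma_finite_measure set 'cV[R]_d -> \bar R} :=
  match d with
  | 0 => @dirac _ 'cV[R]_0 0 R
  | d'.+1 => lebesgue_cVS (lebesgue_cV d')
  end.

(* The half-line (0, +oo), with the topology and the sigma-algebra induced by
   those of R. *)
Definition Rpos (R : realType) : Type := set_type (`]0, +oo[%classic : set R).

Section Rpos.
Context {R : realType}.

Definition Rpos_val : Rpos R -> R := set_val.

HB.instance Definition _ :=
  Topological.copy (Rpos R) (set_type (`]0, +oo[%classic : set R)).

Let one_in : (1%R : R) \in (`]0, +oo[%classic : set R).
Proof. by rewrite inE/= in_itv/= ltr01. Qed.

HB.instance Definition _ := isPointed.Build (Rpos R) (exist _ 1%R one_in).

HB.instance Definition _ :=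
  Measurable.copy (Rpos R) (g_sigma_algebra_preimageType Rpos_val).

Local Open Scope ereal_scope.

Lemma Rpos_gt0 (x : Rpos R) : (0 < Rpos_val x)%R.
Proof. by have := set_valP x; rewrite /= in_itv/= andbT. Qed.

Lemma Rpos_val_inj : injective Rpos_val.
Proof. by move=> x y; exact: val_inj. Qed.

Lemma measurable_Rpos_val : measurable_fun setT Rpos_val.
Proof. by move=> _ B mB; exists B. Qed.

Lemma measurable_Rpos_image (A : set (Rpos R)) :
  measurable A -> measurable (Rpos_val @` A).
Proof.
move=> [B mB <-]; rewrite setTI.
rewrite [X in measurable X](_ : _ = (`]0%R, +oo[%classic : set R) `&` B).
  exact: measurableI.
apply/seteqP; split=> [_ [x Bx <-]|x [x0 Bx]].
  by split=> //=; rewrite in_itv/= Rpos_gt0.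
by exists (exist _ x (mem_set x0)).
Qed.

Definition lebesgue_Rpos (A : set (Rpos R)) : \bar R :=
  lebesgue_measure (Rpos_val @` A).

Let lebesgue_Rpos0 : lebesgue_Rpos set0 = 0.
Proof. by rewrite /lebesgue_Rpos image_set0 measure0. Qed.

Let lebesgue_Rpos_ge0 A : 0 <= lebesgue_Rpos A.
Proof. exact: measure_ge0. Qed.

Let lebesgue_Rpos_additive : semi_sigma_additive lebesgue_Rpos.
Proof.
move=> F mF tF mUF; rewrite /lebesgue_Rpos image_bigcup.
apply: measure_semi_sigma_additive.
- by move=> n; exact: measurable_Rpos_image.
- apply/trivIsetP => /= i j _ _ ij; apply/seteqP; split=> // x.
  case=> -[y Fy <-] [z Fz /Rpos_val_inj zy].
  move/trivIsetP : tF => /(_ i j I I ij) /seteqP[+ _].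
  by apply; split; [exact: Fy|rewrite -zy].
- by rewrite -image_bigcup; exact: measurable_Rpos_image.
Qed.

HB.instance Definition _ := isMeasure.Build _ _ _ lebesgue_Rpos
  lebesgue_Rpos0 lebesgue_Rpos_ge0 lebesgue_Rpos_additive.

Let lebesgue_Rpos_sigma_finite : sigma_finite setT lebesgue_Rpos.
Proof.
have [F TF Foo] := sigma_finiteT (@lebesgue_measure R).
exists (fun n => Rpos_val @^-1` F n).
  by rewrite -preimage_bigcup -TF preimage_setT.
move=> n; have [mF Fn] := Foo n.
have mP : measurable (Rpos_val @^-1` F n).
  by rewrite -[X in measurable X]setTI; exact: measurable_Rpos_val.
split=> //; apply: le_lt_trans Fn; rewrite /lebesgue_Rpos.
apply: le_measure; rewrite ?inE//.
  exact: measurable_Rpos_image.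
exact: image_preimage_subset.
Qed.

HB.instance Definition _ := Measure_isSigmaFinite.Build _ _ _ lebesgue_Rpos
  lebesgue_Rpos_sigma_finite.

End Rpos.

Section kernels_and_transport.
Local Open Scope ereal_scope.
Context {d} {T : measurableType d} {R : realType}.

(* Kernels and measures given by densities are kept as set functions; they are
   only meant to be evaluated on measurable sets.  The library integral takes an
   arbitrary set function and only uses its values on measurable sets. *)
Definition density_measure (lam : {measure set T -> \bar R}) (f : T -> R) :
  set T -> \bar R := fun B => \int[lam]_(x in B) (f x)%:E.

(* pi is the target density and q the proposal density, both with respect to
   the same reference measure. *)
Definition mh_accept (pi q : T -> R) (x y : T) : R :=
  Num.min (pi y * q x / (pi x * q y))%R 1%R.

Definition mh_kernel (lam : {measure set T -> \bar R}) (pi q : T -> R) :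
  T -> set T -> \bar R := fun x B =>
  \int[lam]_(y in B) (mh_accept pi q x y * q y)%:E +
  \d_x B * (1 - \int[lam]_y (mh_accept pi q x y * q y)%:E).

(* P^1 = P and P^t = P P^(t-1) for t >= 2; the value at t = 0 is a convention. *)
Fixpoint kernel_pow (P : T -> set T -> \bar R) (t : nat) :
    T -> set T -> \bar R :=
  match t with
  | 0 => fun x => \d_x
  | 1 => P
  | t'.+1 => fun x B => \int[P x]_y kernel_pow P t' y B
  end.

Definition couplings (mu nu : set T -> \bar R) :
  set (probability (T * T)%type R) :=
  [set xi | (forall A, measurable A -> xi (A `*` setT) = mu A) /\
            (forall B, measurable B -> xi (setT `*` B) = nu B)].

Definition wasserstein (rho : T -> T -> R) (mu nu : set T -> \bar R) : \bar R :=
  ereal_inf [set \int[xi]_z (rho z.1 z.2)%:E |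
    xi in (couplings mu nu : set (probability (T * T)%type R))].

End kernels_and_transport.

Definition is_metric {R : realType} {T : Type} (rho : T -> T -> R) : Prop :=
  [/\ forall x y, 0 <= rho x y,
      forall x y, rho x y = 0 <-> x = y,
      forall x y, rho x y = rho y x &
      forall x y z, rho x z <= rho x y + rho y z].

Definition lsc_metric {R : realType} {T : topologicalType}
    (rho : T -> T -> R) : Prop :=
  is_metric rho /\
  lower_semicontinuous (fun z : T * T => (rho z.1 z.2)%:E).

Section special_functions.
Context {R : realType}.
Notation mu := (@lebesgue_measure R).

Definition Gamma (a : R) : R :=
  \int[mu]_(x in `]0, +oo[) (x `^ (a - 1) * expR (- x)).

(* IG(v, s) is given up to a normalizing constant by x^(-v-1) exp(-s/x) on
   (0, +oo). *)
Definition inv_gamma_fun (v s x : R) : R := x `^ (- v - 1) * expR (- s / x).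

Definition inv_gamma_pdf (v s x : R) : R :=
  inv_gamma_fun v s x / \int[mu]_(y in `]0, +oo[) inv_gamma_fun v s y.

Definition qform d (M : 'M[R]_d) (x : 'cV[R]_d) : R := (x^T *m M *m x) 0 0.

Definition mvnormal_pdf d (m : 'cV[R]_d) (S : 'M[R]_d) (x : 'cV[R]_d) : R :=
  (2 * pi) `^ (- (d%:R / 2)) * (\det S) `^ (- 2^-1) *
  expR (- (qform (invmx S) (x - m) / 2)).

Definition sym_posdef d (C : 'M[R]_d) : Prop :=
  C^T = C /\ forall x : 'cV[R]_d, x != 0 -> 0 < qform C x.

Definition unique_minimizer (T : Type) (f : T -> R) (x : T) : Prop :=
  forall y, y <> x -> f x < f y.

End special_functions.

Notation Theta R d := ('cV[R]_d * Rpos R)%type.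

Definition lebesgue_Theta {R : realType} (d : nat) :
    {measure set (Theta R d) -> \bar R} :=
  (lebesgue_cV d \x @lebesgue_Rpos R)%E.

Section quantile_regression.
Context {R : realType} (d n : nat).
Variables (r v0 s0 : R) (C : 'M[R]_d) (X : 'I_n -> 'cV[R]_d) (Y : 'I_n -> R).

Definition check_loss (u : R) : R := u * (r - (u < 0)%R%:R).

Definition bqr_objective (beta : 'cV[R]_d) : R :=
  \sum_(i < n) check_loss (Y i - (beta^T *m X i) 0 0) + qform (invmx C) beta / 2.

(* Up to a constant, the joint density of (beta, sigma, Y): sigma ~ IG(v0, s0),
   beta | sigma ~ N_d(0, sigma C), Y_i = beta^T X_i + sigma eps_i, where eps_i has
   density r (1 - r) exp(- check_loss eps). *)
Definition bqr_posterior_fun (th : Theta R d) : R :=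
  expR (- ((s0 + bqr_objective th.1) / Rpos_val th.2)
        - (n%:R + v0 + 1 + d%:R / 2) * ln (Rpos_val th.2)).

Definition bqr_posterior_Z : R :=
  \int[lebesgue_Theta d]_th bqr_posterior_fun th.

Definition bqr_posterior_pdf (th : Theta R d) : R :=
  bqr_posterior_Z^-1 * bqr_posterior_fun th.

Definition bqr_posterior : set (Theta R d) -> \bar R :=
  density_measure (lebesgue_Theta d) bqr_posterior_pdf.

(* The normal-inverse-gamma proposal centred at b: sigma has law
   IG(n + v0, s0 + s_{n,r}(b)) and beta, given sigma, has law N_d(b, sigma C). *)
Definition bqr_proposal_pdf (b : 'cV[R]_d) (th : Theta R d) : R :=
  inv_gamma_pdf (n%:R + v0) (s0 + bqr_objective b) (Rpos_val th.2) *
  mvnormal_pdf b (Rpos_val th.2 *: C) th.1.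

Definition bqr_proposal (b : 'cV[R]_d) : set (Theta R d) -> \bar R :=
  density_measure (lebesgue_Theta d) (bqr_proposal_pdf b).

Definition bqr_mh_kernel (b : 'cV[R]_d) :
    Theta R d -> set (Theta R d) -> \bar R :=
  mh_kernel (lebesgue_Theta d) bqr_posterior_pdf (bqr_proposal_pdf b).

Definition bqr_epsilon (b : 'cV[R]_d) : R :=
  bqr_posterior_Z * (2 * pi) `^ (- (d%:R / 2)) * (\det C) `^ (- 2^-1) *
  (s0 + bqr_objective b) `^ (n%:R + v0) * (Gamma (n%:R + v0))^-1.

End quantile_regression.

(* Main.v *)
(* Write s for the objective, b for its minimiser and |.| for the norm given by
   C^-1.  Since s - |.|^2 / 2 is convex, s x >= s b + |x - b|^2 / 2.  The ratio of
   the proposal density to the posterior density at (x, sigma) is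
   eps * exp((s x - s b - |x - b|^2 / 2) / sigma): it is at least eps everywhere
   and equal to eps where x = b.  Hence, from a point a = (b, sigma0), the kernel
   is exactly eps Pi + (1 - eps) delta_a, and as Pi is invariant,
   P^t(a, .) = (1 - (1 - eps)^t) Pi + (1 - eps)^t delta_a.
   For a mixture (1 - c) Pi + c delta_a, the coupling made of (1 - c) times Pi on
   the diagonal and c times (delta_a x Pi) costs c times the integral of
   rho(., a) under Pi, and no coupling is cheaper because the truncations
   min(rho(., a), k) are 1-Lipschitz for rho. *)
Require Import Defs.
From HB Require Import structures.
From mathcomp Require Import all_boot all_order all_algebra.
From mathcomp Require Import all_classical all_reals all_analysis.
From mathcomp Require Import measurable_realfun simple_functions ring lra.
Import Order.TTheory GRing.Theory Num.Theory.
Import numFieldNormedType.Exports.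
Local Open Scope classical_set_scope.
Local Open Scope ring_scope.

Set Implicit Arguments.
Unset Strict Implicit.

(** * Measures given by densities, pushforwards and products *)

(** The kernel leaving [a] is explicit because [q a = eps * pi a]: the acceptance ratio towards [y]
    becomes [eps * pi y / q y], which never exceeds 1, so the minimum is always this ratio and the
    accepted moves have density [eps * pi y]. From other points the kernel has no such form, and all
    that is used of it there is invariance. Two obstacles shape the rest. Kernels, their powers and
    the posterior are bare set functions, so the kernel is handled through its action on nonnegative
    functions, and measures are packaged only where an integration theorem asks for one. The
    integral of [rho] may be infinite and [rho] is only lower semicontinuous: hence the truncations
    in the lower bound, whose integrals are finite and can be subtracted, and hence a countable base
    to make [rho] measurable for the product sigma-algebra. *)

Section density.
Local Open Scope ereal_scope.
Context d (T : measurableType d) (R : realType).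
Variable lam : {measure set T -> \bar R}.
Import HBNNSimple.

(** Packages the bare set function as a measure, which the integration theorems require. *)
Lemma density_measureP (f : T -> R) :
  (forall x, 0 <= f x)%R -> measurable_fun setT f ->
  exists m : {measure set T -> \bar R}, density_measure lam f = m.
Proof.
move=> f0 mf; set mu := density_measure lam f.
have mu0 : mu set0 = 0 by exact: integral_set0.
have mu_ge0 A : 0 <= mu A by apply: integral_ge0 => x _; rewrite lee_fin.
have mu_add : semi_sigma_additive mu.
  move=> F mF tF mUF; rewrite /mu /density_measure ge0_integral_bigcup//=.
  - by apply: is_cvg_ereal_nneg_natsum_cond => n _ _; exact: mu_ge0.
  - by apply/measurable_EFinP; exact: measurable_funTS.
  - by move=> x _; rewrite lee_fin.
pose mix := isMeasure.Build _ _ _ mu mu0 mu_ge0 mu_add.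
pose m : {measure set T -> \bar R} := HB.pack mu mix.
by exists m.
Qed.

Lemma ge0_integral_density (f : T -> R) (g : T -> \bar R) :
  (forall x, 0 <= f x)%R -> measurable_fun setT f ->
  (forall x, 0 <= g x) -> measurable_fun setT g ->
  \int[density_measure lam f]_x g x = \int[lam]_x (g x * (f x)%:E).
Proof.
move=> f0 mf g0 mg; have [m mE] := density_measureP f0 mf; rewrite mE.
have mEf : measurable_fun setT (EFin \o f) by exact/measurable_EFinP.
pose g_ := nnsfun_approx measurableT mg.
have gg_ x : (g_ n x)%:E @[n --> \oo] --> g x.
  by apply: cvg_nnsfun_approx => // y _; exact: g0.
have indE A : measurable A ->
    \int[m]_x (\1_A x)%:E = \int[lam]_x ((\1_A x)%:E * (f x)%:E).
  move=> mA; rewrite integral_indic// setIT -mE /density_measure.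
  rewrite integral_mkcond; apply: eq_integral => x _.
  rewrite patchE indicE; case: ifPn => xA; first by rewrite mul1e.
  by rewrite mul0e.
have sfE (h : {nnsfun T >-> R}) :
    \int[m]_x (h x)%:E = \int[lam]_x ((h x)%:E * (f x)%:E).
  under eq_integral do rewrite fimfunE -fsumEFin//.
  rewrite ge0_integral_fsum//; last 2 first.
  - by move=> r; exact/measurable_EFinP/measurableT_comp.
  - by move=> r x _; rewrite nnfun_muleindic_ge0.
  transitivity (\sum_(r \in range h)
      \int[lam]_x ((r * \1_(h @^-1` [set r]) x)%:E * (f x)%:E)).
    apply: eq_fsbigr => r /set_mem[y _ hyr].
    have r0 : (0 <= r)%R by rewrite -hyr.
    under [RHS]eq_integral do rewrite EFinM -muleA.
    rewrite ge0_integralZl//; last 2 first.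
    - by apply: emeasurable_funM => //; exact/measurable_EFinP.
    - by move=> x _; rewrite mule_ge0// lee_fin.
    rewrite -indE//; under eq_integral do rewrite EFinM.
    by rewrite ge0_integralZl//; exact/measurable_EFinP.
  rewrite -ge0_integral_fsum//.
  - apply: eq_integral => x _; rewrite [in RHS]fimfunE -fsumEFin//.
    by rewrite ge0_mule_fsuml// => r; exact: nnfun_muleindic_ge0.
  - move=> r; apply: emeasurable_funM => //.
    by apply/measurable_EFinP; exact: measurable_funM.
  - by move=> r x _; rewrite mule_ge0 ?nnfun_muleindic_ge0// lee_fin.
transitivity (limn (fun n => \int[m]_x (g_ n x)%:E)).
  rewrite -monotone_convergence//.
  - by apply: eq_integral => x _; apply/esym/cvg_lim => //; exact: gg_.
  - by move=> n; exact/measurable_EFinP.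
  - by move=> n x _; rewrite lee_fin.
  - by move=> x _ a b ab; rewrite lee_fin; exact/lefP/nd_nnsfun_approx.
transitivity (limn (fun n => \int[lam]_x ((g_ n x)%:E * (f x)%:E))).
  by congr (limn _); apply/funext => n; exact: sfE.
rewrite -monotone_convergence//.
- apply: eq_integral => x _; apply/cvg_lim => //.
  by apply: cvgeZr => //; exact: gg_.
- by move=> n; apply: emeasurable_funM => //; exact/measurable_EFinP.
- by move=> n x _; rewrite mule_ge0// lee_fin.
- move=> x _ a b ab; rewrite lee_wpmul2r ?lee_fin//.
  exact/lefP/nd_nnsfun_approx.
Qed.

(** The integral is built from integrals of simple functions, and these evaluate the set function
    only at measurable preimages. Marginals of couplings, known on measurable sets only, can thus be
    substituted under the integral. *)
Lemma eq_integral_measurable (m1 m2 : set T -> \bar R) (g : T -> \bar R) :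
  (forall A, measurable A -> m1 A = m2 A) ->
  \int[m1]_x g x = \int[m2]_x g x.
Proof.
move=> m12; have E (h : {nnsfun T >-> R}) : sintegral m1 h = sintegral m2 h.
  by apply: eq_fsbigr => x _; rewrite m12.
by rewrite /integral; congr (ereal_sup _ - ereal_sup _);
  apply/seteqP; split=> _ [h hg <-]; exists h.
Qed.

End density.

(** A nonnegative function with zero integral vanishes almost everywhere; as [f] vanishes nowhere on
    [D], [D] would be null. *)
Lemma gt0_integral d (T : measurableType d) (R : realType)
    (m : {measure set T -> \bar R})
    (D : set T) (f : T -> R) : measurable D -> m D != 0%E ->
  measurable_fun D f -> (forall x, D x -> 0 < f x) ->
  (0 < \int[m]_(x in D) (f x)%:E)%E.
Proof.
move=> mD mD0 mf f0.
rewrite lt0e integral_ge0 ?andbT; last by move=> x Dx; rewrite lee_fin ltW// f0.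
apply: contra mD0 => /eqP I0.
have : (\int[m]_(x in D) `|(f x)%:E| = 0)%E.
  rewrite -{}I0; apply: eq_integral => x /set_mem Dx.
  by rewrite gee0_abs// lee_fin ltW// f0.
move/(ae_eq_integral_abs m mD (f := EFin \o f)) => h.
have {h} [N [mN N0 DN]] : ae_eq m D (EFin \o f) (cst 0%E).
  by apply: h; exact/measurable_EFinP.
apply/eqP/(subset_measure0 mD mN _ N0) => x Dx; apply: DN => /= /(_ Dx) [].
by apply/eqP; rewrite gt_eqF// f0.
Qed.

Lemma measurable_funV d (T : measurableType d) (R : realType) (f : T -> R) :
  (forall x, 0 < f x) -> measurable_fun setT f ->
  measurable_fun setT (fun x => (f x)^-1).
Proof.
move=> f0 mf; rewrite (_ : (fun x => (f x)^-1) = (@powR R ^~ (-1)) \o f).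
  by apply: measurableT_comp => //; exact: measurable_powR.
by apply/funext => x /=; rewrite powR_inv1// ltW.
Qed.

Section sigma_finite_product.
Local Open Scope ereal_scope.
Context d1 d2 (T1 : measurableType d1) (T2 : measurableType d2) (R : realType).
Variables (m1 : {sigma_finite_measure set T1 -> \bar R}).
Variables (m2 : {sigma_finite_measure set T2 -> \bar R}).

(* The canonical sigma-finite instance on [m1 \x m2] only covers subprobability
   measures, hence this copy. *)
Definition sigma_finite_product : set (T1 * T2)%type -> \bar R := m1 \x m2.

HB.instance Definition _ := Measure.copy sigma_finite_product
  (m1 \x m2 : {measure set (T1 * T2)%type -> \bar R}).

Let sigma_finite_product_sigma_finite : sigma_finite setT sigma_finite_product.
Proof.
have /sigma_finiteP[F [TF ndF Foo]] := sigma_finiteT m1.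
have /sigma_finiteP[G [TG ndG Goo]] := sigma_finiteT m2.
exists (fun n => F n `*` G n).
  rewrite -setXTT TF TG predeqE => -[x y]; split; last first.
    by move=> [n _ []/= ? ?]; split; exists n.
  move=> [/= [n _ Fnx] [k _ Gky]]; exists (maxn n k) => //; split.
  - by move: x Fnx; exact/subsetPset/ndF/leq_maxl.
  - by move: y Gky; exact/subsetPset/ndG/leq_maxr.
move=> k; have [? ?] := Foo k; have [? ?] := Goo k.
split; first exact: measurableX.
rewrite [sigma_finite_product _]product_measure1E//.
by rewrite lte_mul_pinfty// ge0_fin_numE.
Qed.

HB.instance Definition _ := Measure_isSigmaFinite.Build _ _ _
  sigma_finite_product sigma_finite_product_sigma_finite.

End sigma_finite_product.

(** * Independence Metropolis-Hastings kernels *)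

Section metropolis_hastings.
Local Open Scope ereal_scope.
Context d (T : measurableType d) (R : realType).
Variable lam : {sigma_finite_measure set T -> \bar R}.
Variables pi q : T -> R.
Hypotheses (pi_gt0 : forall x, (0 < pi x)%R) (q_gt0 : forall x, (0 < q x)%R).
Hypotheses (mpi : measurable_fun setT pi) (mq : measurable_fun setT q).
Hypothesis int_q : \int[lam]_x (q x)%:E = 1.

Let acc x y : R := (mh_accept pi q x y * q y)%R.

Let acc_ge0 x y : (0 <= acc x y)%R.
Proof.
rewrite mulr_ge0 ?(ltW (q_gt0 _))// /mh_accept le_min ler01 andbT.
by rewrite divr_ge0// mulr_ge0// ltW.
Qed.

Let acc_le x y : (acc x y <= q y)%R.
Proof. by rewrite ger_pMl// ge_min lexx orbT. Qed.

(** Both sides equal the minimum of [pi x * q y] and [pi y * q x], which is symmetric in the two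
    points. *)
Let acc_detailed_balance x y : (pi x * acc x y = pi y * acc y x)%R.
Proof.
suff E u v : (pi u * acc u v = Num.min (pi v * q u) (pi u * q v))%R.
  by rewrite !E minC.
have uv : (0 < pi u * q v)%R by rewrite mulr_gt0.
rewrite /acc mulrCA /mh_accept.
by rewrite minr_pMl ?(ltW uv)// mul1r divfK// gt_eqF.
Qed.

Let macc : measurable_fun setT (fun z : T * T => acc z.1 z.2).
Proof.
have m1 : measurable_fun setT (pi \o fst : T * T -> R).
  exact: measurableT_comp.
have m2 : measurable_fun setT (pi \o snd : T * T -> R).
  exact: measurableT_comp.
have n1 : measurable_fun setT (q \o fst : T * T -> R).
  exact: measurableT_comp.
have n2 : measurable_fun setT (q \o snd : T * T -> R).
  exact: measurableT_comp.
apply: measurable_funM => //; apply: measurable_minr => //.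
apply: measurable_funM; first exact: measurable_funM.
apply: measurable_funV; last exact: measurable_funM.
by move=> z; rewrite mulr_gt0.
Qed.

Let macc1 x : measurable_fun setT (acc x).
Proof. exact: (measurableT_comp macc (pair1_measurable x)). Qed.

Let A x := \int[lam]_y (acc x y)%:E.

Let A_ge0 x : 0 <= A x.
Proof. by apply: integral_ge0 => y _; rewrite lee_fin. Qed.

Let A_le1 x : A x <= 1.
Proof.
rewrite -int_q; apply: ge0_le_integral => //.
- by move=> y _; rewrite lee_fin.
- exact/measurable_EFinP.
- exact/measurable_EFinP.
- by move=> y _; rewrite lee_fin.
Qed.

Let A_fin x : A x \is a fin_num.
Proof. by rewrite ge0_fin_numE// (le_lt_trans (A_le1 x))// ltry. Qed.

Let mA : measurable_fun setT A.
Proof.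
apply: (@measurable_fun_fubini_tonelli_F _ _ T T R lam
  (fun z => (acc z.1 z.2)%:E)).
- by apply/measurable_EFinP; exact: macc.
- by move=> z; rewrite lee_fin.
Qed.

Let subA_ge0 x : 0 <= 1 - A x. Proof. by rewrite sube_ge0 ?A_le1 ?A_fin. Qed.

(** Action of the kernel on functions in closed form. Powers of the kernel become iterates of this
    operator, with no measure structure needed on each power. *)
Definition mh_op (g : T -> \bar R) (x : T) : \bar R :=
  \int[lam]_y (g y * (mh_accept pi q x y * q y)%:E) +
  g x * (1 - \int[lam]_y (mh_accept pi q x y * q y)%:E).

Lemma mh_op_ge0 g x : (forall y, 0 <= g y) -> 0 <= mh_op g x.
Proof.
move=> g0; rewrite adde_ge0//; last by rewrite mule_ge0// subA_ge0.
by apply: integral_ge0 => y _; rewrite mule_ge0// lee_fin acc_ge0.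
Qed.

Let mgacc (g : T -> \bar R) : measurable_fun setT g ->
  measurable_fun setT (fun z : T * T => g z.2 * (acc z.1 z.2)%:E).
Proof.
move=> mg; apply: emeasurable_funM; first exact: measurableT_comp.
by apply/measurable_EFinP; exact: macc.
Qed.

Lemma measurable_mh_op g : (forall y, 0 <= g y) -> measurable_fun setT g ->
  measurable_fun setT (mh_op g).
Proof.
move=> g0 mg; apply: emeasurable_funD.
  apply: (@measurable_fun_fubini_tonelli_F _ _ T T R lam
    (fun z => g z.2 * (acc z.1 z.2)%:E)); first exact: mgacc.
  by move=> z; rewrite mule_ge0// lee_fin.
by apply: emeasurable_funM => //; exact: emeasurable_funB.
Qed.

Lemma integral_mh_kernel g x : (forall y, 0 <= g y) -> measurable_fun setT g ->
  \int[mh_kernel lam pi q x]_y g y = mh_op g x.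
Proof.
move=> g0 mg.
have [m mE] := density_measureP lam (acc_ge0 x) (macc1 x).
have c0 : (0 <= fine (1 - A x))%R by rewrite fine_ge0.
pose c : {nonneg R} := NngNum c0.
(* The kernel at [x] is the law of accepted moves plus the rejected mass, a real number, placed at
   [x]. *)
have -> : mh_kernel lam pi q x =
    measure_add m (mscale c (\d_x : {measure set T -> \bar R})).
  apply/funext => B; rewrite measure_addE -mE /mh_kernel; congr (_ + _).
  transitivity ((fine (1 - A x))%:E * \d_x B); last by [].
  by rewrite fineK; [rewrite muleC|rewrite fin_numB A_fin].
rewrite ge0_integral_measure_add// ge0_integral_mscale//.
rewrite integral_dirac// diracT mul1e -mE ge0_integral_density//.
rewrite [_ * g x]muleC; congr (_ + _ * _).
by apply: fineK; rewrite fin_numB A_fin.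
Qed.

Lemma mh_op_indic x B : measurable B ->
  mh_op (fun y => (\1_B y)%:E) x = mh_kernel lam pi q x B.
Proof.
move=> mB; rewrite /mh_op /mh_kernel diracE indicE; congr (_ + _).
rewrite [RHS]integral_mkcond; apply: eq_integral => y _.
by rewrite patchE indicE; case: ifPn => _; rewrite ?mul1e// mul0e.
Qed.

(** [kernel_pow] treats exponent 1 as a separate case; the third conjunct is a recursion uniform
    from [t = 0] on, suited to inductions. The three claims go together because the recursion at the
    next exponent integrates a function that must be known nonnegative and measurable. *)
Lemma kernel_pow_ge0_measurable t B : measurable B ->
  (forall x, 0 <= kernel_pow (mh_kernel lam pi q) t x B) /\
  measurable_fun setT ((kernel_pow (mh_kernel lam pi q) t) ^~ B) /\
  forall x, kernel_pow (mh_kernel lam pi q) t.+1 x B =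
            mh_op ((kernel_pow (mh_kernel lam pi q) t) ^~ B) x.
Proof.
move=> mB; elim: t => [|t [ih0 [ihm ihE]]].
  split; first by move=> x; exact: measure_ge0.
  have E : (kernel_pow (mh_kernel lam pi q) 0) ^~ B = (fun x => (\1_B x)%:E).
    by apply/funext => x /=; rewrite diracE indicE.
  split; last by move=> x; rewrite E mh_op_indic.
  by rewrite E; apply/measurable_EFinP; exact: measurable_indic.
have E : (kernel_pow (mh_kernel lam pi q) t.+1)^~ B =
    mh_op ((kernel_pow (mh_kernel lam pi q) t)^~ B) by exact/funext.
have h0 x : 0 <= kernel_pow (mh_kernel lam pi q) t.+1 x B.
  by rewrite ihE mh_op_ge0.
have hm : measurable_fun setT ((kernel_pow (mh_kernel lam pi q) t.+1)^~ B).
  by rewrite E; exact: measurable_mh_op.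
by split=> //; split=> // x; rewrite -integral_mh_kernel.
Qed.

(** Under [pi], the mass accepted into a point equals the mass accepted out of it, by detailed
    balance; with the rejected mass it adds up to [pi]. *)
Lemma mh_op_invariant g : (forall y, 0 <= g y) -> measurable_fun setT g ->
  \int[lam]_x (mh_op g x * (pi x)%:E) = \int[lam]_x (g x * (pi x)%:E).
Proof.
move=> g0 mg.
have mpiE : measurable_fun setT (EFin \o pi) by exact/measurable_EFinP.
have pi0 x : 0 <= (pi x)%:E by rewrite lee_fin ltW.
have I0 x : 0 <= \int[lam]_y (g y * (acc x y)%:E).
  by apply: integral_ge0 => y _; rewrite mule_ge0// lee_fin.
have mI : measurable_fun setT (fun x => \int[lam]_y (g y * (acc x y)%:E)).
  apply: (@measurable_fun_fubini_tonelli_F _ _ T T R lam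
    (fun z => g z.2 * (acc z.1 z.2)%:E)); first exact: mgacc.
  by move=> z; rewrite mule_ge0// lee_fin.
have mB : measurable_fun setT (fun x => g x * (1 - A x)).
  by apply: emeasurable_funM => //; exact: emeasurable_funB.
transitivity (\int[lam]_x (\int[lam]_y (g y * (acc x y)%:E) * (pi x)%:E) +
              \int[lam]_x (g x * (1 - A x) * (pi x)%:E)).
  rewrite -ge0_integralD//.
  - apply: eq_integral => x _; rewrite /mh_op ge0_muleDl//.
      exact: I0.
    exact: mule_ge0 (g0 x) (subA_ge0 x).
  - by move=> x _; rewrite mule_ge0.
  - exact: emeasurable_funM.
  - by move=> x _; rewrite mule_ge0// mule_ge0// subA_ge0.
  - exact: emeasurable_funM.
transitivity (\int[lam]_x (g x * A x * (pi x)%:E) +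
              \int[lam]_x (g x * (1 - A x) * (pi x)%:E)).
  congr (_ + _).
  under eq_integral.
    move=> x _; rewrite muleC -ge0_integralZl//; last 2 first.
    - by apply: emeasurable_funM => //; exact/measurable_EFinP.
    - by move=> y _; rewrite mule_ge0// lee_fin.
    over.
  have mh : measurable_fun setT
      (fun z : T * T => (pi z.1)%:E * (g z.2 * (acc z.1 z.2)%:E)).
    apply: emeasurable_funM; last exact: mgacc.
    by apply/measurable_EFinP; exact: measurableT_comp.
  rewrite (@fubini_tonelli _ _ T T R lam lam
    (fun z => (pi z.1)%:E * (g z.2 * (acc z.1 z.2)%:E)))//=; last first.
    by move=> z; rewrite !mule_ge0// lee_fin.
  apply: eq_integral => y _.
  (* After the exchange of integrals, detailed balance turns the inner integral over [x] into
     [A y]. *)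
  under eq_integral do rewrite muleCA -EFinM acc_detailed_balance EFinM muleA.
  rewrite ge0_integralZl//; last by rewrite mule_ge0.
  - by rewrite -muleA [(_ * A y)%E]muleC muleA.
  - exact/measurable_EFinP.
  - by move=> x _; rewrite lee_fin.
rewrite -ge0_integralD//.
- apply: eq_integral => x _; rewrite -ge0_muleDl ?mule_ge0 ?subA_ge0//.
  by rewrite -ge0_muleDr ?subA_ge0// [A x + _]addeC subeK// mule1.
- by move=> x _; rewrite !mule_ge0.
- by apply: emeasurable_funM => //; exact: emeasurable_funM.
- by move=> x _; rewrite !mule_ge0// subA_ge0.
- exact: emeasurable_funM.
Qed.

Lemma integral_kernel_pow t B : measurable B ->
  \int[lam]_x (kernel_pow (mh_kernel lam pi q) t x B * (pi x)%:E) =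
  density_measure lam pi B.
Proof.
move=> mB; elim: t => [|t ih].
  rewrite /density_measure [RHS]integral_mkcond; apply: eq_integral => y _ /=.
  by rewrite patchE diracE; case: ifPn => _; rewrite ?mul1e// mul0e.
have [h0 [hm hE]] := kernel_pow_ge0_measurable t mB.
rewrite -ih -[RHS](mh_op_invariant h0 hm).
by apply: eq_integral => x _; rewrite hE.
Qed.

Hypothesis int_pi : \int[lam]_x (pi x)%:E = 1.
Variables (x0 : T) (eps : R).
Hypothesis eps_le : forall x, (eps * pi x <= q x)%R.
Hypothesis eps_x0 : (eps * pi x0 = q x0)%R.

Let eps_gt0 : (0 < eps)%R.
Proof. by have := q_gt0 x0; rewrite -eps_x0 pmulr_lgt0. Qed.

(** Integrate [eps * pi <= q]: both densities have mass one. *)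
Lemma mh_eps_le1 : (eps <= 1)%R.
Proof.
rewrite -lee_fin -[leRHS]int_q -[eps%:E]mule1 -int_pi -ge0_integralZl//.
- apply: ge0_le_integral => //.
  + by move=> x _; rewrite lee_fin mulr_ge0// ltW.
  + by apply/measurable_EFinP; exact: measurable_funM.
  + exact/measurable_EFinP.
  + by move=> x _; rewrite -EFinM lee_fin.
- exact/measurable_EFinP.
- by move=> x _; rewrite lee_fin ltW.
- by rewrite lee_fin ltW.
Qed.

Let acc_x0 y : acc x0 y = (eps * pi y)%R.
Proof.
rewrite /acc /mh_accept.
have -> : (pi y * q x0 / (pi x0 * q y) = eps * pi y / q y)%R.
  by rewrite -eps_x0; field; rewrite !gt_eqF.
have /min_idPl -> : (eps * pi y / q y <= 1)%R by rewrite ler_pdivrMr// mul1r.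
by rewrite divfK// gt_eqF.
Qed.

Lemma mh_op_x0 g : (forall y, 0 <= g y) -> measurable_fun setT g ->
  mh_op g x0 = eps%:E * \int[lam]_x (g x * (pi x)%:E) + (1 - eps)%:E * g x0.
Proof.
move=> g0 mg; rewrite /mh_op.
have E y : (mh_accept pi q x0 y * q y)%R = (eps * pi y)%R by exact: acc_x0.
under eq_integral do rewrite E EFinM muleCA.
under [X in 1 - X]eq_integral do rewrite E EFinM.
have eps0 : 0 <= eps%:E by rewrite lee_fin ltW.
have pi0 x : 0 <= (pi x)%:E by rewrite lee_fin ltW.
have mpiE : measurable_fun setT (EFin \o pi) by exact/measurable_EFinP.
rewrite (@ge0_integralZl _ T R lam setT measurableT _ mpiE)//; last first.
  by move=> x _; rewrite pi0.
rewrite int_pi mule1 [g x0 * _]muleC ge0_integralZl//.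
  exact: emeasurable_funM.
by move=> x _; rewrite mule_ge0.
Qed.

(** Split off the first step: with weight [eps] the chain is already distributed as the target and
    the other steps preserve this; with weight [1 - eps] it is still at [x0], where the induction
    hypothesis applies. *)
Lemma kernel_pow_x0 t B : measurable B ->
  kernel_pow (mh_kernel lam pi q) t x0 B =
  (1 - (1 - eps) ^+ t)%:E * density_measure lam pi B +
  ((1 - eps) ^+ t)%:E * \d_x0 B.
Proof.
move=> mB; have Pi_fin : density_measure lam pi B \is a fin_num.
  rewrite ge0_fin_numE; last first.
    by apply: integral_ge0 => x _; rewrite lee_fin ltW.
  apply: (@le_lt_trans _ _ 1); last exact: ltry.
  rewrite -int_pi; apply: ge0_subset_integral => //.
    exact/measurable_EFinP.
  by move=> x _; rewrite lee_fin ltW.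
have d_fin : (\d_x0 B : \bar R) \is a fin_num by rewrite diracE.
elim: t => [|t ih]; first by rewrite expr0 subrr mul0e add0e mul1e.
have [h0 [hm ->]] := kernel_pow_ge0_measurable t mB.
rewrite mh_op_x0// integral_kernel_pow// ih.
move: (density_measure lam pi B) (\d_x0 B) Pi_fin d_fin.
move=> [a| |] [b| |] //= _ _.
rewrite -?(EFinM, EFinD).
by congr (_%:E); rewrite exprS; ring.
Qed.

End metropolis_hastings.

(** * Wasserstein distance to a mixture with a point mass *)

Section probability_of_measure.
Context d (T : measurableType d) (R : realType).
Variables (m : {measure set T -> \bar R}) (mT : m setT = 1%E).

(** The proof of unit mass is an argument, so that the probability instance below can recover it
    from the term. *)
Definition probability_of_measure & m setT = 1%E : set T -> \bar R := m.

HB.instance Definition _ := Measure.copy (probability_of_measure mT) m.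
HB.instance Definition _ := @Measure_isProbability.Build _ T R
  (probability_of_measure mT) mT.

Lemma probability_of_measureP :
  exists P : probability T R, m = P :> (set T -> \bar R).
Proof. by exists (probability_of_measure mT). Qed.

End probability_of_measure.

Lemma pushforward_measureP d1 d2 (T1 : measurableType d1)
    (T2 : measurableType d2) (R : realType) (m : {measure set T1 -> \bar R})
    (f : T1 -> T2) :
  measurable_fun setT f ->
  exists m' : {measure set T2 -> \bar R}, pushforward m f = m'.
Proof.
(* Unification picks the canonical measure on the pushforward and leaves the measurability of [f] as
   a shelved goal. *)
move=> mf; eexists; reflexivity.
Unshelve. exact: mf.
Qed.

Section wasserstein_mixture.
Local Open Scope ereal_scope.
Context d (T : measurableType d) (R : realType).

Variables (P : probability T R) (x0 : T) (c : R) (rho : T -> T -> R).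
Hypothesis c01 : (0 <= c <= 1)%R.
Hypothesis rho_metric : is_metric rho.
Hypothesis mrho : measurable_fun setT (fun z : T * T => rho z.1 z.2).
Variable nu : set T -> \bar R.
Hypothesis nuE : forall B, measurable B ->
  nu B = (1 - c)%:E * P B + c%:E * \d_x0 B.

Let rho_ge0 x y : (0 <= rho x y)%R. Proof. by case: rho_metric. Qed.
Let rhoxx x : rho x x = 0%R.
Proof. by case: rho_metric => _ /(_ x x) [_ ->]. Qed.
Let rhoC x y : rho x y = rho y x. Proof. by case: rho_metric. Qed.
Let rho_tri x y z : (rho x z <= rho x y + rho y z)%R.
Proof. by case: rho_metric. Qed.

Let c0 : (0 <= c)%R. Proof. by case/andP: c01. Qed.
Let c'0 : (0 <= 1 - c)%R. Proof. by rewrite subr_ge0; case/andP: c01. Qed.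

Let integral_mixture d' (T' : measurableType d')
    (m1 m2 : {measure set T' -> \bar R}) (f : T' -> \bar R) :
  (forall x, 0 <= f x) -> measurable_fun setT f ->
  \int[measure_add (mscale (NngNum c'0) m1) (mscale (NngNum c0) m2)]_x f x =
  (1 - c)%:E * \int[m1]_x f x + c%:E * \int[m2]_x f x.
Proof.
by move=> f0 mf; rewrite ge0_integral_measure_add// !ge0_integral_mscale.
Qed.

Let wasserstein_mixture_le :
  wasserstein rho nu P <= c%:E * \int[P]_x (rho x x0)%:E.
Proof.
have mdiag : measurable_fun setT (fun x : T => (x, x)).
  exact: measurable_fun_pair.
have mx0 : measurable_fun setT (fun x : T => (x0, x)).
  exact: pair1_measurable.
have [m1 m1E] := pushforward_measureP P mdiag.
have [m2 m2E] := pushforward_measureP P mx0.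
have [mu mu_def] : exists mu : {measure set (T * T) -> \bar R},
    mu = measure_add (mscale (NngNum c'0) m1) (mscale (NngNum c0) m2).
  by eexists.
have muE A : mu A = (1 - c)%:E * P [set x | A (x, x)] +
                    c%:E * P [set x | A (x0, x)].
  rewrite -[P [set x | A (x, x)]]/(pushforward P (fun x => (x, x)) A).
  rewrite -[P [set x | A (x0, x)]]/(pushforward P (fun x => (x0, x)) A).
  by rewrite m1E m2E mu_def; exact: measure_addE.
have muT : mu setT = 1.
  by rewrite muE !probability_setT !mule1 -EFinD subrK.
have [xi xiE] := probability_of_measureP muT.
apply: ereal_inf_lbound; exists xi; first split.
- move=> A mA; rewrite -xiE muE nuE//; congr (_ * P _ + _ * _).
    by apply/seteqP; split=> x /=; [case|].
  (* The section of the cylinder over [A] at [x0] is everything or nothing according to whether [x0]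
     lies in [A], which reproduces the Dirac mass. *)
  rewrite diracE; case: (boolP (x0 \in A)) => x0A.
    rewrite (_ : [set _ | _] = setT) ?probability_setT//.
    by apply/seteqP; split=> x //= _; split=> //; exact: set_mem.
  rewrite (_ : [set _ | _] = set0) ?measure0//.
  by apply/seteqP; split=> x //= [/mem_set]; rewrite (negbTE x0A).
- move=> B mB; rewrite -xiE muE.
  have -> : [set x | (setT `*` B) (x, x)] = B.
    by apply/seteqP; split=> x /=; [case|].
  by rewrite -ge0_muleDl ?lee_fin// -EFinD subrK mul1e.
have mrhoE : measurable_fun setT (fun z : T * T => (rho z.1 z.2)%:E).
  exact/measurable_EFinP.
rewrite -xiE mu_def integral_mixture//; last first.
  by move=> z; rewrite lee_fin.
rewrite -m1E -m2E !ge0_integral_pushforward//; try by move=> z _; rewrite lee_fin.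
(* The diagonal part costs nothing. *)
rewrite !preimage_setT /=; under eq_integral do rewrite rhoxx.
rewrite integral0 mule0 add0e; congr (_ * _).
by apply: eq_integral => x _ /=; rewrite rhoC.
Qed.

Let wasserstein_mixture_ge :
  c%:E * \int[P]_x (rho x x0)%:E <= wasserstein rho nu P.
Proof.
apply: le_ereal_inf_tmp => _ [xi [xi1 xi2] <-].
have mf1 : measurable_fun setT (fun x => rho x x0).
  exact: (measurableT_comp mrho (pair2_measurable x0)).
pose f k x : R := Num.min (rho x x0) k%:R.
have f0 k x : (0 <= f k x)%R by rewrite le_min rho_ge0 ler0n.
have mf k : measurable_fun setT (f k) by exact: measurable_minr.
have mfE k : measurable_fun setT (EFin \o f k) by exact/measurable_EFinP.
have mrhoE : measurable_fun setT (fun z : T * T => (rho z.1 z.2)%:E).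
  exact/measurable_EFinP.
have flip k x y : (f k y <= rho x y + f k x)%R.
  rewrite /f addr_minr le_min; apply/andP; split.
    by rewrite ge_min (rhoC x y) rho_tri.
  by rewrite ge_min lerDr rho_ge0 orbT.
have step k : c%:E * \int[P]_x (f k x)%:E <= \int[xi]_z (rho z.1 z.2)%:E.
  have I2 : \int[xi]_z (f k z.2)%:E = \int[P]_x (f k x)%:E.
    rewrite -(@ge0_integral_pushforward _ _ _ _ _ snd _ xi setT (EFin \o f k))//.
    - by apply: eq_integral_measurable => B mB; rewrite -xi2// /pushforward -setTX.
    - by move=> x _; rewrite lee_fin.
  have I1 : \int[xi]_z (f k z.1)%:E = (1 - c)%:E * \int[P]_x (f k x)%:E.
    rewrite -(@ge0_integral_pushforward _ _ _ _ _ fst _ xi setT (EFin \o f k))//.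
    - transitivity (\int[measure_add (mscale (NngNum c'0) P)
          (mscale (NngNum c0) (\d_x0 : {measure set T -> \bar R}))]_x (f k x)%:E).
        apply: eq_integral_measurable => B mB.
        transitivity (nu B); first by rewrite -xi1// /pushforward -setXT.
        by rewrite nuE// measure_addE.
      rewrite integral_mixture; [|by move=> x; rewrite lee_fin|exact: mfE].
      (* The Dirac part of [nu] contributes zero since [rho x0 x0 = 0]. *)
      rewrite (integral_dirac x0 measurableT (mfE k)) diracT mul1e /= /f rhoxx.
      by rewrite (min_idPl _) ?ler0n// mule0 adde0.
    - by move=> x _; rewrite lee_fin.
  have Ifin : \int[P]_x (f k x)%:E \is a fin_num.
    rewrite ge0_fin_numE; last by apply: integral_ge0 => x _; rewrite lee_fin.
    apply: (@le_lt_trans _ _ (\int[P]_x (k%:R)%:E)).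
      apply: ge0_le_integral => //.
      - by move=> x _; rewrite lee_fin.
      - exact: mfE.
      - by move=> x _; rewrite lee_fin ge_min lexx orbT.
    by rewrite integral_cst//= probability_setT mule1 ltry.
  have : \int[xi]_z (f k z.2)%:E <=
         \int[xi]_z (rho z.1 z.2)%:E + \int[xi]_z (f k z.1)%:E.
    rewrite -ge0_integralD//.
    - apply: ge0_le_integral => //.
      + by move=> z _; rewrite lee_fin.
      + by apply: (measurableT_comp (mfE k)); exact: measurable_snd.
      + apply: emeasurable_funD => //.
        by apply: (measurableT_comp (mfE k)); exact: measurable_fst.
      + by move=> z _; rewrite -EFinD lee_fin.
    - by move=> z _; rewrite lee_fin.
    - by move=> z _; rewrite lee_fin.
    - by apply: (measurableT_comp (mfE k)); exact: measurable_fst.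
  (* If the transport cost is real, subtracting the finite share [1 - c] from both sides leaves the
     factor [c]; an infinite cost is trivial. *)
  rewrite I1 I2; move: Ifin (\int[xi]_z _) => /fineK <- [r| |]//.
  - rewrite -!EFinM -EFinD !lee_fin => h.
    rewrite -(lerD2r ((1 - c) * fine (\int[P]_x (f k x)%:E))) -mulrDl.
    by rewrite addrC subrK mul1r.
  - by rewrite addye ?leey.
have : c%:E * \int[P]_x (f k x)%:E @[k --> \oo] -->
    c%:E * \int[P]_x (rho x x0)%:E.
  apply: cvgeZl => //.
  have -> : \int[P]_x (rho x x0)%:E = \int[P]_x limn (fun k => (f k x)%:E).
    apply: eq_integral => x _; apply/esym/lim_near_cst => //.
    (* At each point the truncations are eventually constant. *)
    near=> k; congr EFin; apply/min_idPl.
    by near: k; exact: nbhs_infty_ger.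
  apply: cvg_monotone_convergence => //.
  - by move=> k x _; rewrite lee_fin.
  - by move=> x _ a b ab; rewrite lee_fin /f le_min2 // ler_nat.
move/cvge_to_le; apply; exact: nearW.
Unshelve. all: by end_near. Qed.

Lemma wasserstein_mixture :
  wasserstein rho nu P = c%:E * \int[P]_x (rho x x0)%:E.
Proof.
by apply/eqP; rewrite eq_le wasserstein_mixture_le wasserstein_mixture_ge.
Qed.

End wasserstein_mixture.

(** * Measurability of lower semicontinuous functions *)

Section countable_base.

(** A second-countability statement in which the base sets are asked to lie in [M], here a family of
    measurable sets, instead of being open. *)
Definition countable_base (T : topologicalType) (M : set (set T)) :=
  exists (I : countType) (F : I -> set T), (forall i, M (F i)) /\
    forall x U, nbhs x U -> exists i, F i x /\ F i `<=` U.

Lemma countable_base_real (R : realType) :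
  countable_base (measurable : set (set R)).
Proof.
exists (rat * rat)%type, (fun ab => `]ratr ab.1, ratr ab.2[%classic).
split=> [ab|x U]; first exact: measurable_itv.
rewrite -nbhs_ballE => -[e /= e0 eU].
have /rat_in_itvoo[a] : x - e < x by rewrite ltrBlDr ltrDl.
rewrite in_itv/= => /andP[xea ax].
have /rat_in_itvoo[b] : x < x + e by rewrite ltrDl.
rewrite in_itv/= => /andP[xb bxe].
exists (a, b); split; first by rewrite /= in_itv/= ax xb.
move=> y /=; rewrite in_itv/= => /andP[ay yb]; apply: eU.
rewrite /ball/= ltr_norml; apply/andP; split.
  by rewrite ltrBrDr addrC ltrBlDl; lra.
by lra.
Qed.

Lemma countable_base_prod (T1 T2 : topologicalType) M1 M2
    (M : set (set (T1 * T2))) :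
  (forall A B, M1 A -> M2 B -> M (A `*` B)) ->
  countable_base M1 -> countable_base M2 -> countable_base M.
Proof.
move=> MX [I [F [MF hF]]] [J [G [MG hG]]].
exists (I * J)%type, (fun ij => F ij.1 `*` G ij.2); split=> [ij|[x y] U].
  exact: MX.
move=> [[A B] /= [Ax By] ABU]; have [i [Fi FA]] := hF _ _ Ax.
have [j [Gj GB]] := hG _ _ By.
exists (i, j); split=> //= -[u v] [/= Fu Gv]; apply: ABU; split=> /=.
  exact: FA.
exact: GB.
Qed.

(** Every neighbourhood of a matrix contains a box of entrywise neighbourhoods, so a matrix of
    indices names a basic box; there are countably many such matrices. *)
Lemma countable_base_mx (R : realType) m n :
  countable_base (measurable : set (set 'M[R]_(m, n))).
Proof.
have [I [F [MF hF]]] := countable_base_real R.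
exists 'M[I]_(m, n), (fun A : 'M[I]_(m, n) =>
  [set M : 'M[R]_(m, n) | forall i j, F (A i j) (M i j)]).
split=> [A|x U [P xP PU]].
  rewrite (_ : [set _ | _] =
      \bigcap_(ij in [set: 'I_m * 'I_n])
        [set M : 'M[R]_(m, n) | F (A ij.1 ij.2) (M ij.1 ij.2)]).
    apply: fin_bigcap_measurable => // ij _; apply: sub_sigma_algebra.
    by exists ij.1, ij.2, (F (A ij.1 ij.2)).
  by apply/seteqP; split=> M /= h => [ij _|i j]; [exact: h|exact: (h (i, j))].
have /choice[g hg] : forall ij : 'I_m * 'I_n, exists k,
    F k (x ij.1 ij.2) /\ F k `<=` P ij.1 ij.2.
  by move=> ij; apply: hF; exact: xP.
exists (\matrix_(i, j) g (i, j)); split=> [i j|M /= FM].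
  by rewrite mxE; exact: (hg (i, j)).1.
by apply: PU => i j; have := FM i j; rewrite mxE; exact: (hg (i, j)).2.
Qed.

Lemma countable_base_Rpos (R : realType) :
  countable_base (measurable : set (set (Rpos R))).
Proof.
have [I [F [MF hF]]] := countable_base_real R.
exists I, (fun i => Rpos_val @^-1` F i); split=> [i|x U].
  by exists (F i) => //; rewrite setTI.
move=> [_ [/= [V oV <-] Vx] VU].
have [i [Fi FV]] := hF _ _ (open_nbhs_nbhs (conj oV Vx)).
by exists i; split=> // y /FV; exact: VU.
Qed.

(** A set [{f > a}] is a neighbourhood of each of its points, hence the union of the countably many
    base sets inside it. The map [g] keeps the space with the topology apart from the one with the
    sigma-algebra; it is the identity in the application. *)
Lemma measurable_lsc (T : topologicalType) d (T' : measurableType d)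
    (R : realType) (g : T' -> T) (f : T -> R) :
  countable_base [set A | measurable (g @^-1` A)] ->
  lower_semicontinuous (EFin \o f) -> measurable_fun setT (f \o g).
Proof.
move=> [I [F [MF hF]]] lscf; apply/measurable_EFinP.
apply: (measurability _ (ErealGenOInfty.measurableE R)).
move=> _ [_ [a ->]] <-; rewrite setTI preimage_itvoy.
rewrite (_ : [set _ | _] = \bigcup_(i in
    [set i | F i `<=` [set x | a%:E < (f x)%:E]%E]) (g @^-1` F i)).
  rewrite bigcup_mkcond; apply: countable_bigcupT_measurable => // i.
  by case: ifPn => // _; exact: MF.
apply/seteqP; split=> x /=.
  move=> /lscf[V nV Va]; have [i [Fi FV]] := hF _ _ nV.
  by exists i => // y /FV; exact: Va.
by move=> [i /= h Fi]; exact: h.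
Qed.

Lemma measurable_lsc_Theta (R : realType) d (f : Theta R d * Theta R d -> R) :
  lower_semicontinuous (EFin \o f) -> measurable_fun setT f.
Proof.
have bT : countable_base (measurable : set (set (Theta R d))).
  apply: countable_base_prod; last exact: countable_base_Rpos.
    by move=> A B; exact: measurableX.
  exact: countable_base_mx.
apply: (@measurable_lsc _ _ (Theta R d * Theta R d)%type R id f).
by apply: (countable_base_prod _ bT bT) => A B; exact: measurableX.
Qed.

End countable_base.

(** * Gaussian integrals *)

Section measurable_qform.
Context (R : realType) d0 (T : measurableType d0).

Lemma measurable_qform d (M : 'M[R]_d) (f : T -> 'cV[R]_d) :
  (forall i, measurable_fun setT (fun x => f x i 0)) ->
  measurable_fun setT (fun x => qform M (f x)).
Proof.
move=> mf; rewrite (_ : (fun x => _) =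
    fun x => \sum_j (\sum_i f x i 0 * M i j) * f x j 0).
  apply: measurable_sum => j; apply: measurable_funM => //.
  by apply: measurable_sum => i; exact: measurable_funM.
apply/funext => x; rewrite /qform mxE; apply: eq_bigr => j _.
by rewrite mxE; congr (_ * _); apply: eq_bigr => i _; rewrite mxE.
Qed.

End measurable_qform.

Lemma measurable_qform_center (R : realType) d (M : 'M[R]_d) (m : 'cV[R]_d) :
  measurable_fun setT (fun x : 'cV[R]_d => qform M (x - m)).
Proof.
apply: measurable_qform => i.
under eq_fun do rewrite !mxE.
by apply: measurable_funD => //; exact: measurable_coord.
Qed.

(** * Schur complement of the corner entry of a positive definite matrix *)

Section schur.
Context (R : realType) (d : nat) (M : 'M[R]_(1 + d)).
Hypothesis Mspd : sym_posdef M.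

Let a := M 0 0.
Let b : 'rV[R]_d := ursubmx M.
Let L : 'M[R]_(1 + d) := block_mx 1%:M (a^-1 *: b) 0 1%:M.

Definition schur : 'M[R]_d := drsubmx M - a^-1 *: (b^T *m b).

Lemma spd_corner_gt0 : 0 < a.
Proof.
have [_ Mpos] := Mspd.
have -> : a = qform M (col_mx (1%:M : 'cV_1) 0).
  rewrite /qform -[in RHS](submxK M) tr_col_mx mul_row_block mul_row_col.
  rewrite !trmx0 !mul0mx !mulmx0 !addr0 trmx1 mul1mx mulmx1.
  by rewrite !mxE; congr (M _ _); apply/val_inj.
apply: Mpos; apply/eqP => /(congr1 (fun A => usubmx A 0 0)).
by rewrite col_mxKu !mxE/= => /eqP; rewrite oner_eq0.
Qed.

(** Completing the square in the first coordinate, in matrix form. Since [L] is unitriangular,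
    determinant and quadratic form both split along the two blocks. *)
Lemma schur_factor : M = L^T *m block_mx a%:M 0 0 schur *m L.
Proof.
have a0 : a != 0 by rewrite gt_eqF// spd_corner_gt0.
have [MT _] := Mspd.
rewrite /L tr_block_mx !mulmx_block !trmx0 !trmx1.
rewrite !(mul0mx, mulmx0, mul1mx, mulmx1, addr0, add0r).
rewrite -[LHS]submxK; congr block_mx.
- rewrite [LHS]mx11_scalar; congr (_%:M).
  by rewrite !mxE; congr (M _ _); apply/val_inj.
- by rewrite mul_scalar_mx scalerA divff// scale1r.
- rewrite mul_mx_scalar linearZ/= scalerA divff// scale1r.
  by rewrite /b trmx_ursub MT.
- rewrite mul_mx_scalar [(_ *: _)^T]linearZ/= scalerA divff// scale1r.
  by rewrite /schur -scalemxAr addrC subrK.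
Qed.

Lemma det_schur : \det M = a * \det schur.
Proof.
rewrite {1}schur_factor !det_mulmx det_tr /L det_ublock !det1 !mulr1 mul1r.
by rewrite det_ublock det_scalar1.
Qed.

Lemma qform_schur (x : 'cV[R]_1) (v : 'cV[R]_d) :
  qform M (col_mx x v) = a * (x 0 0 + a^-1 * (b *m v) 0 0) ^+ 2 + qform schur v.
Proof.
rewrite /qform {1}schur_factor.
have -> : (col_mx x v)^T *m (L^T *m block_mx a%:M 0 0 schur *m L) *m
      col_mx x v =
    (L *m col_mx x v)^T *m block_mx a%:M 0 0 schur *m (L *m col_mx x v).
  by rewrite trmx_mul !mulmxA.
have -> : L *m col_mx x v = col_mx (x + a^-1 *: (b *m v)) v.
  by rewrite mul_block_col !(mul0mx, mul1mx, add0r) -scalemxAl.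
rewrite tr_col_mx mul_row_block mul_row_col !(mulmx0, addr0, add0r).
rewrite mul_mx_scalar mxE; congr (_ + _).
rewrite mxE big_ord1 !mxE; ring.
Qed.

Lemma schur_spd : sym_posdef schur.
Proof.
have [MT Mpos] := Mspd; split=> [|v v0].
  rewrite /schur linearB/= linearZ/= trmx_mul trmxK; congr (_ - _).
  by rewrite trmx_drsub MT.
(* This first coordinate cancels the completed square. *)
have -> : qform schur v = qform M (col_mx (- (a^-1 *: (b *m v))) v).
  by rewrite qform_schur !mxE addNr expr0n/= mulr0 add0r.
apply: Mpos; apply: contra v0 => /eqP/(congr1 dsubmx).
by rewrite col_mxKd linear0 => /eqP.
Qed.

End schur.

Section gaussian_integral.
Context (R : realType).
Local Notation mu := (@lebesgue_measure R).

(** The integrand is the normal density of deviation [s], the inverse square root of [a], divided by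
    its peak; that density has mass one. *)
Lemma integral_gauss1 (a m : R) : 0 < a ->
  (\int[mu]_x (expR (- (a * (x - m) ^+ 2 / 2)))%:E =
   ((2 * pi) `^ 2^-1 * a `^ (- 2^-1))%:E)%E.
Proof.
move=> a0; pose s := (Num.sqrt a)^-1.
have s0 : s != 0 by rewrite invr_eq0 gt_eqF// sqrtr_gt0.
have ss : s ^+ 2 = a^-1 by rewrite exprVn sqr_sqrtr// ltW.
have E x : normal_pdf m s x = normal_peak s * expR (- (a * (x - m) ^+ 2 / 2)).
  rewrite normal_pdfE// /normal_fun ss; congr (_ * expR _).
  by field; rewrite gt_eqF.
have pk : (normal_peak s)^-1 = (2 * pi) `^ 2^-1 * a `^ (- 2^-1).
  rewrite /normal_peak invrK ss -powR12_sqrt; last first.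
    by rewrite mulrn_wge0// mulr_ge0 ?pi_ge0// invr_ge0 ltW.
  rewrite -mulr_natl mulrCA [RHS]mulrC [LHS]powRM; last 2 first.
    by rewrite invr_ge0 ltW.
    by rewrite mulr_ge0 ?pi_ge0.
  by rewrite -(powR_inv1 (ltW a0)) -powRrM mulN1r.
have pk0 := normal_peak_gt0 s0.
have mf : measurable_fun setT
    (fun x : R => (expR (- (a * (x - m) ^+ 2 / 2)))%:E).
  apply/measurable_EFinP/measurableT_comp => //.
  apply: measurable_funN; apply: measurable_funM => //.
  apply: measurable_funM => //; apply: measurable_funX.
  exact: measurable_funB.
rewrite -pk; set I := integral _ _ _.
have h : (1 = (normal_peak s)%:E * I)%E.
  rewrite -(integral_normal_pdf m s) -[RHS]ge0_integralZl//.
  - by apply: eq_integral => x _; rewrite E EFinM.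
  - by rewrite lee_fin ltW.
by rewrite -[I]mul1e -(mulVf (lt0r_neq0 pk0)) EFinM -muleA -h mule1.
Qed.

(** By conversion the measure is the image of a product, so this is Tonelli with the new coordinate
    innermost. *)
Lemma lebesgue_cVS_integral d (f : 'cV[R]_d.+1 -> \bar R) :
  measurable_fun setT f -> (forall x, 0 <= f x)%E ->
  (\int[lebesgue_cV d.+1]_v f v =
   \int[lebesgue_cV d]_v \int[mu]_x f (cons_cV (x, v)))%E.
Proof.
move=> mf f0.
transitivity (\int[pushforward (mu \x lebesgue_cV d) (@cons_cV R d)]_v f v)%E;
  first by [].
have mc := @measurable_cons_cV R d.
rewrite ge0_integral_pushforward// preimage_setT.
have mfc : measurable_fun setT (f \o @cons_cV R d) by exact: measurableT_comp.
rewrite (@fubini_tonelli2 _ _ _ _ _ mu (lebesgue_cV d) _ mfc)// => x.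
exact: f0.
Qed.

(** Here [M] is the inverse covariance. Induction on [d]: integrating out the first coordinate gives
    a one-dimensional Gaussian and leaves the Schur complement. Positivity of the determinant passes
    through the same induction. *)
Lemma integral_gauss d (M : 'M[R]_d) (m : 'cV[R]_d) : sym_posdef M ->
  0 < \det M /\
  (\int[lebesgue_cV d]_x (expR (- (qform M (x - m) / 2)))%:E =
   ((2 * pi) `^ (d%:R / 2) * (\det M) `^ (- 2^-1))%:E)%E.
Proof.
elim: d => [|d ih] in M m *.
  move=> _; rewrite det_mx00; split=> //.
  rewrite powR1 mul0r powRr0 mulr1.
  transitivity (\int[\d_(0%R : 'cV[R]_0)]_x
      (expR (- (qform M (x - m) / 2)))%:E)%E => //.
  have mf : measurable_fun setT
      (fun x : 'cV[R]_0 => (expR (- (qform M (x - m) / 2)))%:E).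
    apply/measurable_EFinP/measurableT_comp => //.
    apply: measurable_funN; apply: measurable_funM => //.
    exact: measurable_qform_center.
  rewrite integral_dirac// diracT mul1e.
  by rewrite /qform mxE big_ord0 mul0r oppr0 expR0.
move=> Mspd; have a0 := spd_corner_gt0 Mspd.
have [S0 hS] := ih (schur M) (@dsubmx _ 1 d 1 m) (schur_spd Mspd).
rewrite (det_schur Mspd) mulr_gt0//; split=> //.
have mf : measurable_fun setT
    (fun x : 'cV[R]_d.+1 => (expR (- (qform M (x - m) / 2)))%:E).
  apply/measurable_EFinP/measurableT_comp => //.
  apply: measurable_funN; apply: measurable_funM => //.
  exact: measurable_qform_center.
rewrite lebesgue_cVS_integral//.
set a := M 0 0 in a0 *.
have E x v : qform M (cons_cV (x, v) - m) =
    a * (x - (m 0 0 - a^-1 *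
      (@ursubmx _ 1 d 1 d M *m (v - @dsubmx _ 1 d 1 m)) 0 0)) ^+ 2 +
    qform (schur M) (v - @dsubmx _ 1 d 1 m).
  have -> : cons_cV (x, v) - m = col_mx (x%:M - @usubmx _ 1 d 1 m)
      (v - @dsubmx _ 1 d 1 m) :> 'cV[R]_(1 + d).
    by rewrite -[in LHS](@vsubmxK _ 1 d 1 m) -add_col_mx -opp_col_mx.
  rewrite (qform_schur Mspd) -/a; congr (a * _ ^+ 2 + _).
  rewrite !mxE eqxx/= mulr1n opprB addrA addrAC; congr (_ - m _ _ + _).
  exact/val_inj.
have mS : measurable_fun setT (fun v : 'cV[R]_d =>
    (expR (- (qform (schur M) (v - @dsubmx _ 1 d 1 m) / 2)))%:E).
  apply/measurable_EFinP/measurableT_comp => //.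
  apply: measurable_funN; apply: measurable_funM => //.
  exact: measurable_qform_center.
transitivity (\int[lebesgue_cV d]_v (((2 * pi) `^ 2^-1 * a `^ (- 2^-1))%:E *
    (expR (- (qform (schur M) (v - @dsubmx _ 1 d 1 m) / 2)))%:E))%E.
  apply: eq_integral => v _.
  (* The centre depends on [v], but the value of the inner integral does not. *)
  set c := m 0 0 - a^-1 * (@ursubmx _ 1 d 1 d M *m (v - @dsubmx _ 1 d 1 m)) 0 0.
  rewrite -(integral_gauss1 c a0) muleC -[RHS]ge0_integralZl//.
  - apply: eq_integral => x _.
    by rewrite E mulrDl opprD expRD EFinM muleC.
  - apply/measurable_EFinP/measurableT_comp => //.
    apply: measurable_funN; apply: measurable_funM => //.
    apply: measurable_funM => //; apply: measurable_funX.
    exact: measurable_funB.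
rewrite ge0_integralZl//; last by rewrite lee_fin mulr_ge0 ?powR_ge0.
rewrite hS -EFinM; congr (_%:E).
rewrite [(a * _) `^ _]powRM; [|exact: ltW|exact: ltW].
rewrite mulrACA; congr (_ * _).
rewrite -powRD; last by rewrite gt_eqF ?implybT// mulr_gt0// pi_gt0.
by congr (_ `^ _); rewrite -[in RHS]natr1 mulrDl addrC mul1r.
Qed.

End gaussian_integral.

(** * The Gamma and inverse gamma integrals *)

Section gamma_integral.
Context (R : realType).
Local Notation mu := (@lebesgue_measure R).

Lemma measurable_itv0y (K : R -> R) :
  (forall x, 0 < x -> {for x, continuous K}) ->
  measurable_fun (`]0, +oo[%classic : set R) (EFin \o K).
Proof.
move=> cK; apply/measurable_EFinP; apply: open_continuous_measurable_fun.
  exact: interval_open.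
by move=> x; rewrite inE/= in_itv/= andbT; exact: cK.
Qed.

Lemma itv0y_bigcup (s : R) : 0 < s ->
  (`]0, +oo[%classic : set R) =
  \bigcup_n `[s / n.+1%:R, s * n.+1%:R]%classic.
Proof.
move=> s0; apply/seteqP; split=> x /=.
  rewrite in_itv/= andbT => x0.
  (* Membership in the interval of index [n] amounts to bounding both [s / x] and [x / s] by
     [n + 1]. *)
  pose n := (Num.bound (s / x) + Num.bound (x / s))%N; exists n => //=.
  rewrite in_itv/=; apply/andP; split.
    rewrite ler_pdivrMr// mulrC -ler_pdivrMr//.
    apply: (le_trans (ltW (archi_boundP _))); first by rewrite divr_ge0// ltW.
    by rewrite ler_nat /n -addnS leq_addr.
  rewrite mulrC -ler_pdivrMr//.
  apply: (le_trans (ltW (archi_boundP _))); first by rewrite divr_ge0// ltW.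
  by rewrite ler_nat /n ltnW// ltnS leq_addl.
move=> [n _]; rewrite /= !in_itv/= andbT => /andP[h _].
by apply: lt_le_trans h; rewrite divr_gt0.
Qed.

Lemma itv0y_nondecreasing (s : R) : 0 < s ->
  nondecreasing_seq (fun n => `[s / n.+1%:R, s * n.+1%:R]%classic : set R).
Proof.
move=> s0 m n mn; apply/subsetPset; apply: subset_itv; rewrite leBSide/=.
  by rewrite ler_pM2l// lef_pV2 ?posrE// ler_nat.
by rewrite ler_pM2l// ler_nat.
Qed.

Lemma continuous_powR_expR (a x : R) (e : R -> R) : 0 < x ->
  {for x, continuous e} ->
  {for x, continuous (fun y => y `^ a * expR (e y))}.
Proof.
move=> x0 ce; apply: continuousM; last first.
  by apply: continuous_comp => //; exact: continuous_expR.
have : {for x, continuous (fun y => expR (a * ln y))}.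
  apply: continuous_comp; last exact: continuous_expR.
  by apply: continuousM; [exact: cst_continuous|exact: continuous_ln].
rewrite /prop_for /continuous_at /= => h.
(* [powR] branches on a zero base; near a positive point it is the exponential form. *)
rewrite {2}/powR gt_eqF//; apply: cvg_trans h; apply: near_eq_cvg.
near=> y; rewrite /powR gt_eqF//.
near: y; exact: lt_nbhsr.
Unshelve. all: by end_near. Qed.

Section inverse.
Variable s : R.
Hypothesis s0 : 0 < s.
Let F (y : R) := s / y.

Let dF (x : R) : 0 < x -> is_derive x 1 F (- s / x ^+ 2).
Proof.
move=> x0; have xn0 : x != 0 by rewrite gt_eqF.
have h : is_derive x 1 (s \*: (fun y : R => y^-1)) (s *: (- x ^- 2 *: 1)).
  by apply: is_deriveZ; exact: is_deriveV.
rewrite (_ : - s / x ^+ 2 = s *: (- x ^- 2 *: 1)); first exact: h.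
by rewrite /GRing.scale/= mulr1 mulrN mulNr.
Qed.

Let F'E (x : R) : 0 < x -> derive1 F x = - s / x ^+ 2.
Proof. by move=> x0; rewrite derive1E; have [_] := dF x0. Qed.

Let cF' (x : R) : 0 < x -> {for x, continuous (derive1 F)}.
Proof.
move=> x0; have : {for x, continuous (fun y : R => - s / y ^+ 2)}.
  apply: continuousM; first exact: cst_continuous.
  apply: continuousV; first by rewrite expf_neq0// gt_eqF.
  exact: exprn_continuous.
rewrite /prop_for /continuous_at F'E// => h; apply: cvg_trans h.
apply: near_eq_cvg; near=> y; rewrite F'E//.
by near: y; exact: lt_nbhsr.
Unshelve. all: by end_near. Qed.

(** Substitution by [s / y] on compact intervals, then a limit. The map sends the interval from
    [1 / n.+1] to [n.+1] onto that from [s / n.+1] to [s * n.+1], so the two exhaustions agree index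
    by index. *)
Lemma integral_inverse (G : R -> R) :
  (forall x, 0 < x -> {for x, continuous G}) -> (forall x, 0 <= G x) ->
  (\int[mu]_(x in `]0%R, +oo[) (G x)%:E =
   \int[mu]_(y in `]0%R, +oo[) (G (s / y) * (s / y ^+ 2))%:E)%E.
Proof.
move=> cG G0.
have cF (x : R) : 0 < x -> {for x, continuous F}.
  move=> x0; apply: differentiable_continuous; apply/derivable1_diffP.
  by have [] := dF x0.
pose H y := G (s / y) * (s / y ^+ 2).
have cH (x : R) : 0 < x -> {for x, continuous H}.
  move=> x0; apply: continuousM.
    apply: (@continuous_comp _ _ _ F G); first exact: cF.
    by apply: cG; rewrite divr_gt0.
  apply: continuousM; first exact: cst_continuous.
  apply: continuousV; first by rewrite expf_neq0// gt_eqF.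
  exact: exprn_continuous.
have s'0 : 0 < (1 : R) by [].
have c1 : (\int[mu]_(x in `[(s / n.+1%:R)%R, (s * n.+1%:R)%R]) (G x)%:E)%E
    @[n --> \oo] -->
    (\int[mu]_(x in `]0%R, +oo[) (G x)%:E)%E.
  rewrite (itv0y_bigcup s0); apply: ge0_nondecreasing_set_cvg_integral.
  - exact: itv0y_nondecreasing.
  - by move=> i; exact: measurable_itv.
  - move=> i; apply: measurable_funS (measurable_itv0y cG) => //.
    by rewrite (itv0y_bigcup s0); move=> x Fx; exists i.
  - by move=> i x _; rewrite lee_fin.
have c2 : (\int[mu]_(x in `[(1 / n.+1%:R)%R, (1 * n.+1%:R)%R]) (H x)%:E)%E
    @[n --> \oo] -->
    (\int[mu]_(x in `]0%R, +oo[) (H x)%:E)%E.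
  rewrite (itv0y_bigcup s'0); apply: ge0_nondecreasing_set_cvg_integral.
  - exact: itv0y_nondecreasing.
  - by move=> i; exact: measurable_itv.
  - move=> i; apply: measurable_funS (measurable_itv0y cH) => //.
    by rewrite (itv0y_bigcup s'0); move=> x Fx; exists i.
  - move=> i x _; rewrite lee_fin mulr_ge0// divr_ge0 ?(ltW s0)//.
    exact: sqr_ge0.
rewrite -(cvg_lim _ c1)// -(cvg_lim _ c2)//; congr (limn _); apply/funext => n.
have := @integration_by_substitution_decreasing R F G
  (1 / n.+1%:R) (1 * n.+1%:R).
have n0 : 0 < 1 / n.+1%:R :> R by rewrite divr_gt0.
have n1 : 0 < 1 * n.+1%:R :> R by rewrite mulr_gt0.
have nn : 1 / n.+1%:R <= 1 * n.+1%:R :> R.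
  by rewrite !mul1r; apply: (@le_trans _ _ 1); rewrite ?invf_le1// ler1n.
have -> : s / n.+1%:R = F (1 * n.+1%:R) by rewrite /F mul1r.
have -> : s * n.+1%:R = F (1 / n.+1%:R) by rewrite /F div1r invrK.
move=> ->//.
- apply: eq_integral => x; rewrite inE/= in_itv/= => /andP[x1 _].
  have x0 : 0 < x by exact: lt_le_trans x1.
  by congr (_%:E); rewrite /H !fctE/= F'E// mulNr opprK.
- move=> x y; rewrite !in_itv/= => /andP[x1 _] /andP[y1 _] xy.
  have x0 : 0 < x by exact: lt_le_trans x1.
  have y0 : 0 < y by exact: lt_le_trans y1.
  by rewrite /F ltr_pM2l// ltf_pV2.
- move=> x; rewrite in_itv/= => /andP[x1 _].
  by apply: cF'; exact: lt_trans x1.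
- by apply/cvg_ex; eexists; apply: cvg_at_right_filter; exact: cF'.
- by apply/cvg_ex; eexists; apply: cvg_at_left_filter; exact: cF'.
- split.
  + move=> x; rewrite in_itv/= => /andP[x1 _].
    by have [] := dF (lt_trans n0 x1).
  + by apply: cvg_at_right_filter; exact: cF.
  + by apply: cvg_at_left_filter; exact: cF.
- apply: continuous_in_subspaceT => x; rewrite inE/= in_itv/= => /andP[x1 _].
  by apply: cG; apply: lt_le_trans x1; rewrite divr_gt0.
Qed.

End inverse.

Lemma gamma_integrand_continuous (v x : R) : 0 < x ->
  {for x, continuous (fun y => y `^ (v - 1) * expR (- y))}.
Proof.
by move=> x0; apply: continuous_powR_expR => //; exact: opp_continuous.
Qed.

Lemma integral_gamma_fin (v : R) : 1 < v ->
  (\int[mu]_(x in `]0%R, +oo[) (x `^ (v - 1) * expR (- x))%:E < +oo)%E.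
Proof.
move=> v1; have a0 : 0 < v - 1 by rewrite subr_gt0.
set a := v - 1 in a0 *.
have h2 : 0 < 2^-1 :> R by [].
(* [ln t <= t - 1] at [t = x / (2 a)] *)
have bound (x : R) : 0 < x ->
    x `^ a * expR (- x) <= 2 * (2 * a) `^ a * exponential_pdf 2^-1 x.
  move=> x0; rewrite exponential_pdfE ?(ltW x0)//=.
  rewrite mulrA [2 * _ * 2^-1]mulrAC divff// mul1r.
  rewrite /powR !gt_eqF// ?mulr_gt0// -!expRD ler_expR.
  have xa : 0 < x / (2 * a) by rewrite divr_gt0// mulr_gt0.
  have : ln (1 + (x / (2 * a) - 1)) <= x / (2 * a) - 1.
    by apply: le_ln1Dx; rewrite ltrBDr addNr.
  rewrite addrCA subrr addr0 ln_div ?posrE ?mulr_gt0// => h.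
  have : a * (ln x - ln (2 * a)) <= a * (x / (2 * a) - 1) by rewrite ler_pM2l.
  have -> : a * (x / (2 * a) - 1) = x / 2 - a by field; rewrite gt_eqF.
  by lra.
apply: (@le_lt_trans _ _ (\int[mu]_(x in `]0%R, +oo[)
    ((2 * (2 * a) `^ a)%:E * (exponential_pdf 2^-1 x)%:E))%E).
  apply: ge0_le_integral => //.
  - by move=> x _; rewrite lee_fin mulr_ge0 ?powR_ge0 ?expR_ge0.
  - by apply: measurable_itv0y => x; exact: gamma_integrand_continuous.
  - apply: emeasurable_funM => //; apply/measurable_EFinP.
    by apply: measurable_funTS; exact: measurable_exponential_pdf.
  - by move=> x; rewrite /= in_itv/= andbT -EFinM lee_fin; exact: bound.
have mexp (D : set R) : measurable_fun D (EFin \o exponential_pdf (2^-1 : R)).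
  apply/measurable_EFinP; apply: measurable_funTS.
  exact: measurable_exponential_pdf.
have exp0 (x : R) : (0 <= (exponential_pdf 2^-1 x)%:E)%E.
  by rewrite lee_fin exponential_pdf_ge0// ltW.
rewrite ge0_integralZl//; last by rewrite lee_fin mulr_ge0 ?powR_ge0.
rewrite lte_mul_pinfty ?lee_fin ?mulr_ge0 ?powR_ge0//.
apply: (@le_lt_trans _ _ 1%E); last exact: ltry.
rewrite -(@integral_exponential_pdf R 2^-1)//.
by apply: ge0_subset_integral => //; exact: mexp.
exact: mexp.
Qed.

(** [Gamma] is the real part of an extended integral and would take a default value at infinity;
    finiteness rules this out. *)
Lemma GammaE (v : R) : 1 < v ->
  (\int[mu]_(x in `]0%R, +oo[) (x `^ (v - 1) * expR (- x))%:E = (Gamma v)%:E)%E.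
Proof.
move=> v1; rewrite /Gamma /Rintegral fineK// ge0_fin_numE ?integral_gamma_fin//.
by apply: integral_ge0 => x _; rewrite lee_fin mulr_ge0 ?powR_ge0 ?expR_ge0.
Qed.

Lemma Gamma_gt0 (v : R) : 1 < v -> 0 < Gamma v.
Proof.
move=> v1; rewrite -lte_fin -GammaE//.
apply: (@gt0_integral _ (measurableTypeR R) _ mu) => //.
- apply/eqP => D0; have := lebesgue_measure_itv (`]0, +oo[ : interval R).
  by rewrite /= ltry => Dy; have := etrans (esym D0) Dy.
- apply/measurable_EFinP.
  exact: measurable_itv0y (@gamma_integrand_continuous v).
- move=> x; rewrite /= in_itv/= andbT => x0.
  by rewrite mulr_gt0 ?powR_gt0 ?expR_gt0.
Qed.

Lemma measurable_inv_gamma_fun (v s : R) :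
  measurable_fun (`]0, +oo[%classic : set R) (EFin \o inv_gamma_fun v s).
Proof.
apply: measurable_itv0y => x x0; apply: continuous_powR_expR => //.
apply: continuousM; first exact: cst_continuous.
by apply: continuousV; [rewrite gt_eqF|exact: cvg_id].
Qed.

(** The substitution by [s / x] in the Gamma integral yields [s] to the power [v] times this
    integrand. *)
Lemma integral_inv_gamma (v s : R) : 1 < v -> 0 < s ->
  (\int[mu]_(x in `]0%R, +oo[) (inv_gamma_fun v s x)%:E =
   (Gamma v * s `^ (- v))%:E)%E.
Proof.
move=> v1 s0.
have : ((Gamma v)%:E =
    (s `^ v)%:E * \int[mu]_(x in `]0%R, +oo[) (inv_gamma_fun v s x)%:E)%E.
  rewrite -GammaE//.
  rewrite (integral_inverse s0 (@gamma_integrand_continuous v)); last first.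
    by move=> x; rewrite mulr_ge0 ?powR_ge0 ?expR_ge0.
  rewrite -ge0_integralZl//.
  - apply: eq_integral => x; rewrite inE/= in_itv/= andbT => x0.
    rewrite -EFinM /inv_gamma_fun; congr (_%:E).
    have -> : s / x ^+ 2 = expR (ln s - 2 * ln x).
      rewrite expRB lnK ?posrE//; congr (_ / _).
      by rewrite mulrC -powR_mulrn ?ltW// /powR gt_eqF// mulrC.
    have sx : 0 < s / x by rewrite divr_gt0.
    rewrite /powR !gt_eqF// ln_div ?posrE// -!expRD.
    by congr expR; rewrite mulNr; ring.
  - exact: measurable_inv_gamma_fun.
  - by move=> x _; rewrite lee_fin mulr_ge0 ?powR_ge0 ?expR_ge0.
  - by rewrite lee_fin powR_ge0.
have sv : 0 < s `^ v by rewrite powR_gt0.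
set I := integral _ _ _ => h.
rewrite powRN mulrC EFinM h muleA -EFinM mulVf ?gt_eqF//.
by rewrite mul1e.
Qed.

End gamma_integral.

(** * Positive definite matrices and the multivariate normal density *)

Section spd.
Context (R : realType) (d : nat).

Lemma spd_det_gt0 (C : 'M[R]_d) : sym_posdef C -> 0 < \det C.
Proof. by move=> /(integral_gauss 0)[]. Qed.

Lemma spd_unitmx (C : 'M[R]_d) : sym_posdef C -> C \in unitmx.
Proof. by move=> /spd_det_gt0 C0; rewrite unitmxE unitfE gt_eqF. Qed.

Lemma spd_invmx (C : 'M[R]_d) : sym_posdef C -> sym_posdef (invmx C).
Proof.
move=> Cspd; have uC := spd_unitmx Cspd; have [CT Cpos] := Cspd.
have MT : (invmx C)^T = invmx C by rewrite trmx_inv CT.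
split=> // x x0.
have -> : qform (invmx C) x = qform C (invmx C *m x).
  by rewrite /qform trmx_mul MT !mulmxA mulmxKV.
apply: Cpos; apply: contra x0 => /eqP h.
by rewrite -[x](mulKVmx uC) h mulmx0.
Qed.

Lemma qformZ (a : R) (M : 'M[R]_d) x : qform (a *: M) x = a * qform M x.
Proof. by rewrite /qform -scalemxAr -scalemxAl mxE. Qed.

Lemma spdZ (a : R) (C : 'M[R]_d) : 0 < a -> sym_posdef C -> sym_posdef (a *: C).
Proof.
move=> a0 [CT Cpos]; split=> [|x x0]; first by rewrite linearZ/= CT.
by rewrite qformZ mulr_gt0// Cpos.
Qed.

Lemma qform_ge0 (M : 'M[R]_d) x : sym_posdef M -> 0 <= qform M x.
Proof.
move=> [_ Mpos]; have [->|/Mpos/ltW//] := eqVneq x 0.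
by rewrite /qform mulmx0 mxE.
Qed.

(** Bilinear expansion. The last term is the exact convexity defect, the source of strong convexity
    of the objective. *)
Lemma qform_interp (M : 'M[R]_d) (x y : 'cV[R]_d) (t : R) :
  qform M ((1 - t) *: x + t *: y) =
  (1 - t) * qform M x + t * qform M y - t * (1 - t) * qform M (y - x).
Proof.
pose B (u v : 'cV[R]_d) := (u^T *m M *m v) 0 0.
have BDl u u' v : B (u + u') v = B u v + B u' v.
  by rewrite /B [(u + u')^T]linearD/= !mulmxDl mxE.
have BDr u v v' : B u (v + v') = B u v + B u v' by rewrite /B mulmxDr mxE.
have BZl a u v : B (a *: u) v = a * B u v.
  by rewrite /B [(a *: u)^T]linearZ/= -!scalemxAl mxE.
have BZr a u v : B u (a *: v) = a * B u v by rewrite /B -scalemxAr mxE.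
have BNl u v : B (- u) v = - B u v by rewrite -scaleN1r BZl mulN1r.
have BNr u v : B u (- v) = - B u v by rewrite -scaleN1r BZr mulN1r.
rewrite -![qform M _]/(B _ _) !(BDl, BDr, BZl, BZr, BNl, BNr); ring.
Qed.

Lemma measurable_mvnormal_pdf (m : 'cV[R]_d) (S : 'M[R]_d) :
  measurable_fun setT (mvnormal_pdf m S).
Proof.
apply: measurable_funM => //; apply: measurableT_comp => //.
apply: measurable_funN; apply: measurable_funM => //.
exact: measurable_qform_center.
Qed.

Lemma integral_mvnormal_pdf (m : 'cV[R]_d) (S : 'M[R]_d) : sym_posdef S ->
  (\int[lebesgue_cV d]_x (mvnormal_pdf m S x)%:E = 1)%E.
Proof.
move=> Sspd; have S0 := spd_det_gt0 Sspd.
have [_ hM] := integral_gauss m (spd_invmx Sspd).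
under eq_integral do rewrite EFinM.
rewrite ge0_integralZl//.
- rewrite hM -EFinM det_inv; congr (_%:E).
  rewrite -(powR_inv1 (ltW S0)) -powRrM mulN1r opprK mulrACA.
  have pw (x c : R) : 0 < x -> x `^ (- c) * x `^ c = 1.
    by move=> x0; rewrite powRN mulVf// gt_eqF// powR_gt0.
  by rewrite !pw ?mulr1// mulr_gt0// pi_gt0.
- apply/measurable_EFinP/measurableT_comp => //.
  apply: measurable_funN; apply: measurable_funM => //.
  exact: measurable_qform_center.
- by rewrite lee_fin mulr_ge0 ?powR_ge0.
Qed.

End spd.

(** The image of [lebesgue_Rpos] in the line is Lebesgue measure with the indicator of the half-line
    as density. *)
Lemma integral_Rpos (R : realType) (f : R -> \bar R) :
  measurable_fun (`]0, +oo[%classic : set R) f ->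
  (forall x : R, (0 < x)%R -> 0 <= f x)%E ->
  (\int[@lebesgue_Rpos R]_x f (Rpos_val x) =
   \int[lebesgue_measure]_(x in `]0%R, +oo[) f x)%E.
Proof.
move=> mf f0; pose D := `]0, +oo[%classic : set R; pose g := f \_ D.
have mD : measurable (D : set (measurableTypeR R)) by exact: measurable_itv.
have mg : measurable_fun setT g.
  by apply/(measurable_restrictT f) => //; exact: measurable_itv.
have g0 x : (0 <= g x)%E.
  by rewrite /g patchE; case: ifPn => // /set_mem; rewrite /D/= in_itv/= andbT;
    exact: f0.
transitivity (\int[@lebesgue_Rpos R]_x (g \o @Rpos_val R) x)%E.
  apply: eq_integral => x _ /=; rewrite /g patchE ifT//; apply: mem_set.
  by rewrite /D/= in_itv/= andbT; exact: Rpos_gt0.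
have mval : measurable_fun setT (@Rpos_val R : Rpos R -> measurableTypeR R).
  exact: measurable_Rpos_val.
rewrite -(@ge0_integral_pushforward _ _ _ _ _ _ mval
  (@lebesgue_Rpos R) setT g)//.
rewrite [RHS]integral_mkcond -/g.
transitivity (\int[density_measure lebesgue_measure
    (\1_D : R -> R)]_x g x)%E.
  apply: (@eq_integral_measurable _ (measurableTypeR R) R) => A mA.
  rewrite /density_measure integral_indic// /pushforward /lebesgue_Rpos.
  congr (lebesgue_measure _); apply/seteqP; split=> x /=.
    move=> [y Ay <-]; split=> //.
    by rewrite /D/= in_itv/= andbT; exact: Rpos_gt0.
  by move=> [x0 Ax]; exists (exist _ x (mem_set x0)).
rewrite ge0_integral_density//.
apply: eq_integral => x _; rewrite /g patchE indicE.
by case: ifPn => _; rewrite ?mule1 ?mule0.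
Qed.

(** * Bayesian quantile regression *)

Section check_loss.
Context (R : realType) (r : R).
Hypothesis r01 : 0 < r < 1.

(** As a maximum of two linear maps, the loss shows its sign, convexity and measurability. *)
Lemma check_lossE (u : R) : check_loss r u = Num.max (r * u) ((r - 1) * u).
Proof.
rewrite /check_loss; have [u0|u0] := ltP u 0; rewrite ?subr0 mulrC.
  by rewrite (max_idPr _)// ler_nM2r// ltW// ltrBlDr ltrDl.
by rewrite (max_idPl _)// ler_wpM2r// lerBlDr lerDl.
Qed.

Lemma check_loss_ge0 (u : R) : 0 <= check_loss r u.
Proof.
case/andP: r01 => r0 r1; rewrite check_lossE le_max.
have [u0|u0] := leP 0 u; first by rewrite mulr_ge0// ltW.
by apply/orP; right; rewrite nmulr_rge0 ?subr_lt0// ltW.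
Qed.

Lemma check_loss_convex (t u v : R) : 0 <= t <= 1 ->
  check_loss r ((1 - t) * u + t * v) <=
  (1 - t) * check_loss r u + t * check_loss r v.
Proof.
move=> /andP[t0 t1]; have t'0 : 0 <= 1 - t by rewrite subr_ge0.
have le1 w : r * w <= check_loss r w by rewrite check_lossE le_max lexx.
have le2 w : (r - 1) * w <= check_loss r w.
  by rewrite check_lossE le_max lexx orbT.
rewrite [leLHS]check_lossE ge_max; apply/andP; split.
  have := ler_wpM2l t'0 (le1 u); have := ler_wpM2l t0 (le1 v); lra.
have := ler_wpM2l t'0 (le2 u); have := ler_wpM2l t0 (le2 v); lra.
Qed.

Lemma measurable_check_loss : measurable_fun setT (check_loss r : R -> R).
Proof.
rewrite (_ : check_loss r = fun u => Num.max (r * u) ((r - 1) * u)).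
  by apply: measurable_maxr; exact: measurable_funM.
by apply/funext => u; rewrite check_lossE.
Qed.

End check_loss.

Section bqr.
Context (R : realType) (d n : nat) (r v0 s0 : R) (C : 'M[R]_d).
Context (X : 'I_n -> 'cV[R]_d) (Y : 'I_n -> R) (bstar : 'cV[R]_d).
Hypotheses (n_ge1 : (1 <= n)%N) (r01 : 0 < r < 1) (v0_gt0 : 0 < v0).
Hypotheses (s0_gt0 : 0 < s0) (C_spd : sym_posdef C).
Local Notation obj := (bqr_objective r C X Y).
Hypothesis bstar_min : unique_minimizer obj bstar.

Let Q := qform (invmx C).

Lemma bqr_objective_interp (x y : 'cV[R]_d) (t : R) : 0 <= t <= 1 ->
  obj ((1 - t) *: x + t *: y) <=
  (1 - t) * obj x + t * obj y - t * (1 - t) * (Q (y - x) / 2).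
Proof.
move=> t01; rewrite /bqr_objective qform_interp -/Q.
set L := fun b : 'cV[R]_d => \sum_(i < n) check_loss r (Y i - (b^T *m X i) 0 0).
have : L ((1 - t) *: x + t *: y) <= (1 - t) * L x + t * L y.
  rewrite /L !mulr_sumr -big_split/=; apply: ler_sum => i _.
  rewrite (le_trans _ (check_loss_convex r _ _ t01))//.
  rewrite [(_ + _)^T]linearD/= ![(_ *: _)^T]linearZ/= mulmxDl -!scalemxAl !mxE.
  by rewrite le_eqVlt; apply/orP; left; apply/eqP; congr check_loss; ring.
rewrite -/(L x) -/(L y) -/(L _); lra.
Qed.

(** Compare the minimum with the value at a point of the segment from [bstar] to [b]: dividing by
    [t] leaves the bound with a factor [1 - t], and [t] can be taken small. *)
Lemma bqr_objective_growth (b : 'cV[R]_d) :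
  obj bstar + Q (b - bstar) / 2 <= obj b.
Proof.
have le_obj y : obj bstar <= obj y.
  by have [->//|/eqP/bstar_min/ltW] := eqVneq y bstar.
have W0 : 0 <= Q (b - bstar) / 2.
  by rewrite divr_ge0//; exact/qform_ge0/spd_invmx.
have step t : 0 < t < 1 -> (1 - t) * (Q (b - bstar) / 2) <= obj b - obj bstar.
  move=> /andP[t0 t1].
  have t01 : 0 <= t <= 1 by rewrite !ltW.
  have := le_trans (le_obj _) (bqr_objective_interp bstar b t01).
  by move=> h; rewrite -(ler_pM2l t0); lra.
rewrite addrC -lerBrDr leNgt; apply/negP => lt_W.
set W := Q _ / 2 in W0 step lt_W *; set D := obj b - obj bstar in step lt_W *.
have D0 : 0 <= D by rewrite subr_ge0.
have Wgt0 : 0 < W by exact: le_lt_trans lt_W.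
(* In place of a limit: [(1 - t) * W = D] at [t = (W - D) / W], and half of this [t] already makes
   the left side exceed [D]. *)
have WD : 0 < (W - D) / (2 * W) < 1.
  have W2 : 0 < 2 * W by rewrite mulr_gt0.
  apply/andP; split; first by rewrite divr_gt0// subr_gt0.
  by rewrite ltr_pdivrMr//; lra.
have := step _ WD.
have -> : (1 - (W - D) / (2 * W)) * W = (W + D) / 2 by field; rewrite gt_eqF.
lra.
Qed.

Lemma bqr_objective_ge0 b : 0 <= obj b.
Proof.
rewrite addr_ge0//; first by apply: sumr_ge0 => i _; exact: check_loss_ge0.
by rewrite divr_ge0//; exact/qform_ge0/spd_invmx.
Qed.

Lemma measurable_bqr_objective : measurable_fun setT obj.
Proof.
apply: measurable_funD.
  apply: measurable_sum => i; apply: measurableT_comp.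
    exact: measurable_check_loss.
  apply: measurable_funB => //.
  rewrite (_ : (fun x => _) = fun x : 'cV[R]_d => \sum_j x j 0 * X i j 0).
    apply: measurable_sum => j; apply: measurable_funM => //.
    exact: measurable_coord.
  by apply/funext => x; rewrite mxE; apply: eq_bigr => j _; rewrite mxE.
apply: measurable_funM => //; apply: measurable_qform => i.
exact: measurable_coord.
Qed.

Let mobj : measurable_fun setT (fun th : Theta R d => obj th.1).
Proof. by apply: measurableT_comp measurable_bqr_objective _. Qed.

Let msig : measurable_fun setT (fun th : Theta R d => Rpos_val th.2).
Proof. by apply: measurableT_comp; first exact: measurable_Rpos_val. Qed.

Let msigV : measurable_fun setT (fun th : Theta R d => (Rpos_val th.2)^-1).
Proof. by apply: measurable_funV msig => th; exact: Rpos_gt0. Qed.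

(** * Comparison of the proposal and posterior densities *)

Local Notation pifun := (bqr_posterior_fun r v0 s0 C X Y).
Local Notation pipdf := (bqr_posterior_pdf r v0 s0 C X Y).
Local Notation q := (bqr_proposal_pdf r v0 s0 C X Y bstar).
Local Notation lam := (lebesgue_Theta d).
Let nu := n%:R + v0.
Let S := s0 + obj bstar.

Let nu_gt1 : 1 < nu.
Proof.
by rewrite /nu -[ltLHS]addr0 ler_ltD// ler1n.
Qed.

Let S_gt0 : 0 < S.
Proof. by rewrite /S ltr_pwDl// bqr_objective_ge0. Qed.

Lemma measurable_bqr_posterior_fun :
  measurable_fun setT (pifun : Theta R d -> R).
Proof.
apply: measurableT_comp => //; apply: measurable_funB.
  apply: measurable_funN; apply: measurable_funM => //.
  exact: measurable_funD.
apply: measurable_funM => //; apply: measurableT_comp msig.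
exact: measurable_ln.
Qed.

(** [bqr_epsilon] without its factor [bqr_posterior_Z], for comparison with the unnormalized
    posterior. *)
Let K := (2 * pi) `^ (- (d%:R / 2)) * (\det C) `^ (- 2^-1) *
  S `^ nu * (Gamma nu)^-1.

Let K_gt0 : 0 < K.
Proof.
rewrite /K !mulr_gt0 ?powR_gt0 ?invr_gt0 ?Gamma_gt0 ?spd_det_gt0//.
by rewrite mulr_gt0// pi_gt0.
Qed.

(** The powers of sigma cancel: the inverse gamma factor gives exponent [- nu - 1], the determinant
    of the scaled covariance gives [- d / 2], and the posterior carries exactly their sum. Only the
    exponentials differ. *)
Lemma bqr_proposal_pdfE (th : Theta R d) :
  q th = K *
    expR ((obj th.1 - (obj bstar + Q (th.1 - bstar) / 2)) / Rpos_val th.2) *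
    pifun th.
Proof.
case: th => b sig; set x := Rpos_val sig; have x0 : 0 < x by exact: Rpos_gt0.
rewrite /bqr_proposal_pdf /inv_gamma_pdf /mvnormal_pdf /=.
have -> : \int[lebesgue_measure]_(y in `]0, +oo[)
    inv_gamma_fun (n%:R + v0) (s0 + obj bstar) y = Gamma nu * S `^ (- nu).
  by rewrite /Rintegral integral_inv_gamma.
rewrite invfM powRN invrK detZ invmxZ; last first.
  by rewrite unitmxZ ?unitfE ?gt_eqF// spd_unitmx.
rewrite qformZ -/Q -/nu -/S.
rewrite [(x ^+ d * _) `^ _]powRM; last 2 first.
- by rewrite exprn_ge0// ltW.
- exact/ltW/spd_det_gt0.
have -> : (x ^+ d) `^ (- 2^-1) = expR (- (d%:R / 2) * ln x).
  rewrite -powR_mulrn ?(ltW x0)// -powRrM /powR gt_eqF//; congr expR; ring.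
rewrite /inv_gamma_fun {1}/powR gt_eqF// /bqr_posterior_fun /= -/x -/nu.
set c1 := (2 * pi) `^ _; set c2 := _ `^ (- 2^-1); set c3 := S `^ nu.
rewrite -[RHS]mulrA.
transitivity (K * (expR ((- nu - 1) * ln x) * expR (- S / x) *
  (expR (- (d%:R / 2) * ln x) * expR (- (x^-1 * Q (b - bstar) / 2))))).
  rewrite /K -/c1 -/c2 -/c3; ring.
(* With powers of sigma written as exponentials of [ln x], comparing exponents is a field
   identity. *)
rewrite -!expRD; congr (_ * expR _).
rewrite /S; field; by rewrite gt_eqF.
Qed.

Lemma measurable_bqr_proposal_pdf : measurable_fun setT (q : Theta R d -> R).
Proof.
rewrite (_ : q = fun th : Theta R d =>
  K * expR ((obj th.1 - (obj bstar + Q (th.1 - bstar) / 2)) / Rpos_val th.2)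
    * pifun th); last by apply/funext => th; exact: bqr_proposal_pdfE.
apply: measurable_funM; last exact: measurable_bqr_posterior_fun.
apply: measurable_funM => //; apply: measurableT_comp => //.
apply: measurable_funM => //; apply: measurable_funB => //.
apply: measurable_funD => //; apply: measurable_funM => //.
exact: (measurableT_comp (measurable_qform_center (invmx C) bstar)
  measurable_fst).
Qed.

Lemma bqr_posterior_fun_gt0 th : 0 < pifun th. Proof. exact: expR_gt0. Qed.

Lemma bqr_proposal_pdf_gt0 th : 0 < q th.
Proof.
rewrite bqr_proposal_pdfE.
exact: mulr_gt0 (mulr_gt0 K_gt0 (expR_gt0 _)) (bqr_posterior_fun_gt0 _). Qed.

Lemma bqr_proposal_pdf_ge th : K * pifun th <= q th.
Proof.
rewrite bqr_proposal_pdfE -mulrA ler_pM2l//.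
rewrite ler_peMl ?(ltW (bqr_posterior_fun_gt0 _))//.
rewrite -[leLHS]expR0 ler_expR divr_ge0// ?subr_ge0; last exact/ltW/Rpos_gt0.
exact: bqr_objective_growth.
Qed.

Lemma bqr_proposal_pdf_center sig : q (bstar, sig) = K * pifun (bstar, sig).
Proof.
rewrite bqr_proposal_pdfE /= subrr /Q /qform mulmx0 mxE mul0r addr0 subrr mul0r.
by rewrite expR0 mulr1.
Qed.

(** Integrate beta first at fixed sigma: the normal factor has mass one and an inverse gamma density
    remains. *)
Lemma integral_bqr_proposal_pdf : (\int[lam]_th (q th)%:E = 1)%E.
Proof.
have mq : measurable_fun setT (fun th : Theta R d => (q th)%:E).
  by apply/measurable_EFinP; exact: measurable_bqr_proposal_pdf.
have q0 (th : Theta R d) : (0 <= (q th)%:E)%E.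
  by rewrite lee_fin ltW// bqr_proposal_pdf_gt0.
have I_gt0 : 0 < Gamma nu * S `^ (- nu).
  by rewrite mulr_gt0 ?powR_gt0// Gamma_gt0.
have Iig : \int[lebesgue_measure]_(y in `]0, +oo[) inv_gamma_fun nu S y =
    Gamma nu * S `^ (- nu) by rewrite /Rintegral integral_inv_gamma.
have ig0 x : 0 <= inv_gamma_pdf nu S x.
  rewrite /inv_gamma_pdf Iig divr_ge0 ?(ltW I_gt0)//.
  by rewrite mulr_ge0 ?powR_ge0 ?expR_ge0.
rewrite /lebesgue_Theta (fubini_tonelli2 _ mq q0).
transitivity (\int[@lebesgue_Rpos R]_s (inv_gamma_pdf nu S (Rpos_val s))%:E)%E.
  apply: eq_integral => s _.
  rewrite /fubini_G /bqr_proposal_pdf /=.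
  under eq_integral do rewrite EFinM.
  rewrite ge0_integralZl//.
  - rewrite integral_mvnormal_pdf ?mule1//.
    by apply: spdZ => //; exact: Rpos_gt0.
  - by apply/measurable_EFinP; exact: measurable_mvnormal_pdf.
  - by move=> x _; rewrite lee_fin !mulr_ge0 ?powR_ge0 ?expR_ge0.
  - by rewrite lee_fin ig0.
have mig : measurable_fun (`]0, +oo[%classic : set R)
    (EFin \o inv_gamma_fun nu S).
  exact: measurable_inv_gamma_fun.
have igE x : (inv_gamma_pdf nu S x)%:E =
    (((Gamma nu * S `^ (- nu))^-1)%:E * (inv_gamma_fun nu S x)%:E)%E.
  by rewrite /inv_gamma_pdf Iig -EFinM mulrC.
rewrite (@integral_Rpos _ (fun x => (inv_gamma_pdf nu S x)%:E)).
- transitivity (\int[lebesgue_measure]_(x in `]0%R, +oo[)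
      (((Gamma nu * S `^ (- nu))^-1)%:E * (inv_gamma_fun nu S x)%:E))%E.
    by apply: eq_integral => x _; exact: igE.
  rewrite ge0_integralZl//.
  + by rewrite integral_inv_gamma// -EFinM mulVf// gt_eqF.
  + by move=> x _; rewrite lee_fin mulr_ge0 ?powR_ge0 ?expR_ge0.
  + by rewrite lee_fin invr_ge0 ltW.
- rewrite (_ : (fun x => _) = fun x => (((Gamma nu * S `^ (- nu))^-1)%:E *
      (inv_gamma_fun nu S x)%:E)%E); last exact/funext.
  by apply: emeasurable_funM.
- by move=> x _; rewrite lee_fin.
Qed.

Let mpifunE : measurable_fun setT (fun th : Theta R d => (pifun th)%:E).
Proof. by apply/measurable_EFinP; exact: measurable_bqr_posterior_fun. Qed.

(** Finiteness comes from domination by the proposal: [K * pifun <= q], and [q] has mass one. *)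
Lemma bqr_posterior_ZE :
  (\int[lam]_th (pifun th)%:E = (bqr_posterior_Z r v0 s0 C X Y)%:E)%E.
Proof.
rewrite /bqr_posterior_Z /Rintegral fineK// ge0_fin_numE; last first.
  by apply: integral_ge0 => th _; rewrite lee_fin ltW// bqr_posterior_fun_gt0.
apply: (@le_lt_trans _ _ (\int[lam]_th ((K^-1)%:E * (q th)%:E))%E).
  apply: ge0_le_integral => //.
  - by move=> th _; rewrite lee_fin ltW// bqr_posterior_fun_gt0.
  - apply: emeasurable_funM => //.
    by apply/measurable_EFinP; exact: measurable_bqr_proposal_pdf.
  - move=> th _; rewrite -EFinM lee_fin mulrC ler_pdivlMr// mulrC.
    exact: bqr_proposal_pdf_ge.
rewrite ge0_integralZl//.
- by rewrite integral_bqr_proposal_pdf mule1 ltry.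
- by apply/measurable_EFinP; exact: measurable_bqr_proposal_pdf.
- by move=> th _; rewrite lee_fin ltW// bqr_proposal_pdf_gt0.
- by rewrite lee_fin invr_ge0 ltW.
Qed.

Lemma bqr_posterior_Z_gt0 : 0 < bqr_posterior_Z r v0 s0 C X Y.
Proof.
rewrite -lte_fin -bqr_posterior_ZE; apply: gt0_integral => //.
(* The reference measure is not null, since [q] would then integrate to zero. *)
- apply/eqP => lam0; have := integral_bqr_proposal_pdf.
  rewrite null_set_integral//; first by move=> /eqP; rewrite eq_sym onee_eq0.
  by apply/measurable_EFinP; exact: measurable_bqr_proposal_pdf.
- exact: measurable_bqr_posterior_fun.
- by move=> th _; exact: bqr_posterior_fun_gt0.
Qed.

Lemma integral_bqr_posterior_pdf : (\int[lam]_th (pipdf th)%:E = 1)%E.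
Proof.
have Z0 := bqr_posterior_Z_gt0.
under eq_integral do rewrite /bqr_posterior_pdf EFinM.
rewrite ge0_integralZl//.
- by rewrite bqr_posterior_ZE -EFinM mulVf// gt_eqF.
- by move=> th _; rewrite lee_fin ltW// bqr_posterior_fun_gt0.
- by rewrite lee_fin invr_ge0 ltW.
Qed.

Lemma bqr_epsilon_posterior_pdf th :
  bqr_epsilon r v0 s0 C X Y bstar * pipdf th = K * pifun th.
Proof.
rewrite /bqr_epsilon /bqr_posterior_pdf -/nu -/S /K; field.
by rewrite !gt_eqF ?bqr_posterior_Z_gt0 ?Gamma_gt0.
Qed.

End bqr.

(** [lebesgue_Theta] is typed as a mere measure, while the Metropolis-Hastings results use Tonelli
    and ask for a sigma-finite one. *)
Lemma lebesgue_Theta_sigma_finite (R : realType) d :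
  exists lam : {sigma_finite_measure set (Theta R d) -> \bar R},
    lebesgue_Theta d = lam.
Proof. by exists (sigma_finite_product (lebesgue_cV d) (@lebesgue_Rpos R)). Qed.

Unset Implicit Arguments.
Set Strict Implicit.

Theorem theorem2 (R : realType) (d n : nat) (r v0 s0 : R) (C : 'M[R]_d)
    (X : 'I_n -> 'cV[R]_d) (Y : 'I_n -> R) (bstar : 'cV[R]_d)
    (d_ge1 : (1 <= d)%N) (n_ge1 : (1 <= n)%N)
    (r01 : 0 < r < 1) (v0_gt0 : 0 < v0) (s0_gt0 : 0 < s0)
    (C_spd : sym_posdef C)
    (bstar_min : unique_minimizer (bqr_objective r C X Y) bstar)
    (proposal_neq : exists2 B, measurable B &
       bqr_proposal r v0 s0 C X Y bstar B <> bqr_posterior r v0 s0 C X Y B)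
    (sigma0 : Rpos R) (rho : Theta R d -> Theta R d -> R)
    (rho_lsc : lsc_metric rho) (t : nat) (t_ge1 : (1 <= t)%N) :
  wasserstein rho
    (kernel_pow (bqr_mh_kernel r v0 s0 C X Y bstar) t (bstar, sigma0))
    (bqr_posterior r v0 s0 C X Y)
  = (((1 - bqr_epsilon r v0 s0 C X Y bstar) ^+ t)%:E *
     \int[bqr_posterior r v0 s0 C X Y]_th (rho th (bstar, sigma0))%:E)%E.
Proof.
set eps := bqr_epsilon _ _ _ _ _ _ _.
set pipdf := bqr_posterior_pdf r v0 s0 C X Y.
set q := bqr_proposal_pdf r v0 s0 C X Y bstar.
have [lam lamE] := lebesgue_Theta_sigma_finite R d.
have Z0 : 0 < bqr_posterior_Z r v0 s0 C X Y.
  exact: (bqr_posterior_Z_gt0 n_ge1 r01 v0_gt0 s0_gt0 C_spd bstar_min).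
have pi0 th : 0 < pipdf th.
  by rewrite mulr_gt0 ?invr_gt0// bqr_posterior_fun_gt0.
have q0 th : 0 < q th by exact: bqr_proposal_pdf_gt0.
have mpi : measurable_fun setT pipdf.
  by apply: measurable_funM => //; exact: measurable_bqr_posterior_fun.
have mq : measurable_fun setT q by exact: measurable_bqr_proposal_pdf.
have Iq : (\int[lebesgue_Theta d]_th (q th)%:E = 1)%E.
  exact: integral_bqr_proposal_pdf.
have Ipi : (\int[lebesgue_Theta d]_th (pipdf th)%:E = 1)%E.
  exact: (integral_bqr_posterior_pdf n_ge1 r01 v0_gt0 s0_gt0 C_spd bstar_min).
rewrite lamE in Iq Ipi.
have eps_le th : eps * pipdf th <= q th.
  by rewrite bqr_epsilon_posterior_pdf//; exact: bqr_proposal_pdf_ge.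
have eps_eq : eps * pipdf (bstar, sigma0) = q (bstar, sigma0).
  by rewrite bqr_epsilon_posterior_pdf// /q bqr_proposal_pdf_center.
have eps1 : eps <= 1 := mh_eps_le1 pi0 q0 mpi mq Iq Ipi eps_le eps_eq.
have eps0 : 0 < eps by have := q0 (bstar, sigma0); rewrite -eps_eq pmulr_lgt0.
have [m mE] := density_measureP lam (fun th => ltW (pi0 th)) mpi.
have mT : m setT = 1%E by rewrite -mE.
have [P PE] := probability_of_measureP mT.
have postE : bqr_posterior r v0 s0 C X Y = P.
  by rewrite /bqr_posterior lamE mE PE.
rewrite postE; case: rho_lsc => rho_metric rho_low.
(* Here [c] is [(1 - eps) ^+ t], which lies between 0 and 1 because [0 < eps <= 1]. *)
apply: wasserstein_mixture => //.
- by rewrite exprn_ge0 ?exprn_ile1 ?subr_ge0// gerBl ltW.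
- by apply: measurable_lsc_Theta.
- move=> B mB; rewrite /bqr_mh_kernel lamE -PE -mE.
  exact: kernel_pow_x0.
Qed.
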